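(* Let $p>3$ be a prime. Then $$\sum_{k=0}^{p-1}\frac{k\binom{2k}k^3}{(-8)^k}(H_{2k}-H_k)-\frac{(-1)^{(p-1)/2}}6\equiv\begin{cases}-2(q_p(2)+1)x^2/3\pmod p&\text{if } p=x^2+y^2\ (x,y\in\mathbb Z,\ 2\nmid x),\\0\pmod p&\text{if } p\equiv 3\pmod 4.\end{cases}$$ We also have $$\left(\frac{-2}p\right)\sum_{k=0}^{p-1}\frac{k\binom{2k}k^3}{(-512)^k}(H_{2k}-H_k)-\frac16\equiv\begin{cases}-(3q_p(2)+2)x^2/3\pmod p&\text{if } p=x^2+y^2\ (x,y\in\mathbb Z,\ 2\nmid x),\\0\pmod p&\text{if } p\equiv 3\pmod 4.\end{cases}$$
   Context: $H_k=\sum_{0<j\le k}\frac1j$ denotes the $k$-th harmonic number ($H_0=0$), and $q_p(2)=(2^{p-1}-1)/p$ is the Fermat quotient. $\left(\frac{\cdot}{p}\right)$ is the Legendre symbol. A congruence $s\equiv t\pmod p$ between rational numbers means $s-t\in p\,\mathbb Z_{(p)}$, where $\mathbb Z_{(p)}$ is the ring of rational numbers with denominator prime to $p$. *)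

(* Defs.v *)
From mathcomp Require Import all_boot all_order all_algebra.

Set Implicit Arguments.
Unset Strict Implicit.
Unset Printing Implicit Defensive.

Import Order.TTheory GRing.Theory Num.Theory.
Local Open Scope ring_scope.

Definition harmonic (k : nat) : rat := \sum_(1 <= j < k.+1) (j%:R)^-1.

(* Kept in rat because the congruences are between rationals. *)
Definition fermat_quotient (p a : nat) : rat :=
  ((a ^ (p - 1))%:R - 1) / p%:R.

(* The Legendre symbol, intended for p an odd prime. *)
Definition legendre (a : int) (p : nat) : int :=
  if (p%:Z %| a)%Z then 0
  else if [exists x : 'I_p, (x%:Z ^+ 2 == a %[mod p%:Z])%Z] then 1
  else -1.

(* The subring Z_(p) of rat; denq r is the reduced, positive denominator. *)
Definition Zloc (p : nat) : pred rat := [pred r | coprime `|denq r|%N p].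

Definition rat_eqmod (p : nat) (s t : rat) : Prop :=
  exists2 r : rat, r \in Zloc p & s - t = p%:R * r.

Definition harmonic_sum (p : nat) (m : rat) : rat :=
  \sum_(0 <= k < p)
    (k * 'C(2 * k, k) ^ 3)%:R / m ^+ k * (harmonic (2 * k) - harmonic k).

(* Main.v *)
Require Import Defs.
From HB Require Import structures.
From mathcomp Require Import all_boot all_order all_algebra finfield ring zify.

Set Implicit Arguments.
Unset Strict Implicit.
Unset Printing Implicit Defensive.

Import Order.TTheory GRing.Theory Num.Theory.
Local Open Scope ring_scope.

(* Let p = 2n+1. Modulo p, C(2k,k) = (-4)^k C(n,k), so the two sums become sums
   of k C(n,k)^3 x^k (H_{2k} - H_k) with x = 8 and x = 1/8, and k |-> n-k
   exchanges them. Over the dual numbers F_p[e]/(e^2), the e-part of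
     3F2(1/2, 1/2+2e, 1/2+e; 1+e, 1+2e; -8)
   carries the weights H_{2k} - H_k; since -8 = 4t(1-t) for t = -1, Clausen's
   formula, valid for the truncated series because e^2 = 0, makes it the square
   of 2F1(1/2, 1/2+2e; 1+e; t) at t = -1, and differentiating in t brings in the
   factor k. At t = -1 the symmetry k |-> n-k leaves few unknowns: they are
   determined by the Wronskian of the two solutions of the hypergeometric
   equation, which is (1 - t^p)/(1-t) in characteristic p, and by the derivative
   in x of sum_k (-1)^k C(x,k) C(x,n-k) = (-1)^(n/2) C(x,n/2). The Fermat
   quotient q enters through H_n = -2q and H_{n/2} = -3q, and Gauss' congruence
   C(n,n/2)^2 = 4x^2, obtained from Jacobsthal sums, evaluates what remains. *)

(** * Dual numbers *)

(** The upper parameter 1/2 stays undeformed because k + 1/2 must vanish exactly at k = n for the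
    deformed series to stop there. Clausen's condition A + B + 1 = 2C ties the remaining shifts
    together; in the 3F2 the shifts add up to 3e above and below, which makes the e-part a multiple
    of H_{2k} - H_k. The obstacle is the sum weighted by both k and H_k, which is never evaluated:
    it enters the target only through its product with the plain alternating sum, and the Wronskian
    contains the same product. The terms (-1)^((p-1)/2)/6 and 1/6 of the theorem are what the value
    1 of the Wronskian at t = -1 contributes. For odd n the alternating sum is 0 by reversal, and
    nothing else remains. *)

Section Dual.
Variable F : comNzRingType.

Record dual := Dual { dre : F; deps : F }.

Definition dual_pair (x : dual) := (dre x, deps x).
Definition pair_dual (x : F * F) := Dual x.1 x.2.

Fact dual_pairK : cancel dual_pair pair_dual. Proof. by case. Qed.

HB.instance Definition _ := Choice.copy dual (can_type dual_pairK).

Definition dadd (x y : dual) := Dual (dre x + dre y) (deps x + deps y).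
Definition dopp (x : dual) := Dual (- dre x) (- deps x).
Definition dmul (x y : dual) :=
  Dual (dre x * dre y) (dre x * deps y + deps x * dre y).

Fact daddA : associative dadd.
Proof. by move=> x y z; congr Dual => /=; ring. Qed.
Fact daddC : commutative dadd.
Proof. by move=> x y; congr Dual => /=; ring. Qed.
Fact dadd0 : left_id (Dual 0 0) dadd.
Proof. by case=> x y; congr Dual => /=; ring. Qed.
Fact daddN : left_inverse (Dual 0 0) dopp dadd.
Proof. by move=> x; congr Dual => /=; ring. Qed.

HB.instance Definition _ :=
  GRing.isZmodule.Build dual daddA daddC dadd0 daddN.

Fact dmulA : associative dmul.
Proof. by move=> x y z; congr Dual => /=; ring. Qed.
Fact dmulC : commutative dmul.
Proof. by move=> x y; congr Dual => /=; ring. Qed.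
Fact dmul1 : left_id (Dual 1 0) dmul.
Proof. by case=> x y; congr Dual => /=; ring. Qed.
Fact dmulDl : left_distributive dmul +%R.
Proof. by move=> x y z; congr Dual => /=; ring. Qed.
Fact dual_1neq0 : Dual 1 0 != 0.
Proof. by apply/eqP => -[] /eqP; rewrite oner_eq0. Qed.

HB.instance Definition _ := GRing.Zmodule_isComNzRing.Build dual
  dmulA dmulC dmul1 dmulDl dual_1neq0.

Lemma dual_ext x y : dre x = dre y -> deps x = deps y -> x = y.
Proof. by case: x y => [a b] [c d] /= -> ->. Qed.

Lemma dreM x y : dre (x * y) = dre x * dre y. Proof. by []. Qed.
Lemma depsM x y : deps (x * y) = dre x * deps y + deps x * dre y.
Proof. by []. Qed.
Lemma dreD x y : dre (x + y) = dre x + dre y. Proof. by []. Qed.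
Lemma depsD x y : deps (x + y) = deps x + deps y. Proof. by []. Qed.
Lemma dreN x : dre (- x) = - dre x. Proof. by []. Qed.
Lemma depsN x : deps (- x) = - deps x. Proof. by []. Qed.
Lemma dre1 : dre 1 = 1. Proof. by []. Qed.
Lemma deps1 : deps 1 = 0. Proof. by []. Qed.

Lemma dre_nat k : dre k%:R = k%:R.
Proof. by elim: k => // k IHk; rewrite -!natr1 dreD IHk. Qed.

Lemma deps_nat k : deps k%:R = 0.
Proof. by elim: k => // k IHk; rewrite -natr1 depsD IHk add0r. Qed.

Definition dualE := (dre_nat, deps_nat, dre1, deps1, dreN, depsN,
  dreM, depsM, dreD, depsD).

Lemma dre_sum (I : Type) (r : seq I) (P : pred I) (u : I -> dual) :
  dre (\sum_(i <- r | P i) u i) = \sum_(i <- r | P i) dre (u i).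
Proof. exact: (big_morph dre dreD). Qed.

Lemma deps_sum (I : Type) (r : seq I) (P : pred I) (u : I -> dual) :
  deps (\sum_(i <- r | P i) u i) = \sum_(i <- r | P i) deps (u i).
Proof. exact: (big_morph deps depsD). Qed.

End Dual.

(** * Clausen's formula for polynomials *)

(* The third order equation satisfied by the square of a solution of
   [s y'' + C s' y' = ab y], where [s = x (1 - x)]. *)
Definition sym_square_ode (R : comNzRingType) (C ab : R) (w : {poly R}) :
    {poly R} :=
  let s : {poly R} := 'X * (1 - 'X) in
  let v := s * w^`()^`() + C%:P * s^`() * w^`() - 2 * ab%:P * w in
  s * v^`() - (1 - 2 * C%:P) * s^`() * v - 2 * ab%:P * s * w^`().

(** For [y = g^2] and [t = s'], substituting g'' turns s y'' + c s' y' - 2ab y into [v = 2 s g'^2].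
    Differentiating [v] and substituting g'' again gives the third order equation. *)
Lemma sym_square_identity (K : comNzRingType) (s t g g1 g2 ab c : K) :
  s * g2 = ab * g - c * t * g1 ->
  let v := 2 * s * g1 ^+ 2 in
  s * (2 * g1 ^+ 2) + s * (2 * (g * g2)) + c * t * (2 * (g * g1))
    - 2 * ab * g ^+ 2 = v
  /\ s * (2 * t * g1 ^+ 2 + 4 * s * g1 * g2) - (1 - 2 * c) * t * v
    - 2 * ab * s * (2 * (g * g1)) = 0.
Proof. by move=> e /=; split; ring: e. Qed.

(* The same equation for [f0 = phi (x (1 - x))], where [phi] solves the 3F2
   equation (the hypothesis), [f1 f2 f3] are the derivatives of [phi] and
   [s = x (1 - x)], [t = s']. *)
Lemma clausen_identity (K : comNzRingType) (s t f0 f1 f2 f3 ab c : K) :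
  t ^+ 2 = 1 - 4 * s ->
  s ^+ 2 * f3 + 3 * c * s * f2 + c * (2 * c - 1) * f1 =
    4 * s ^+ 3 * f3 + (6 + 12 * c) * s ^+ 2 * f2
    + (8 * c ^+ 2 + 4 * c + 4 * ab) * s * f1 + 2 * (2 * c - 1) * ab * f0 ->
  let v := s * (f2 * t * t - 2 * f1) + c * t * (f1 * t) - 2 * ab * f0 in
  let v' := t * (f2 * t * t - 2 * f1)
    + s * (f3 * t * t * t - 4 * f2 * t - 2 * f2 * t)
    + c * (- 2 * (f1 * t) + t * (f2 * t * t - 2 * f1)) - 2 * ab * (f1 * t) in
  s * v' - (1 - 2 * c) * t * v - 2 * ab * s * (f1 * t) = 0.
Proof.
move=> et /eqP; rewrite -subr_eq0 => /eqP ef /=.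
by rewrite -[RHS](mulr0 t) -ef; ring: et.
Qed.

(** The terms are sorted by what their k-th coefficient reads: the first three are X^i w^(i+1) and
    read index k + 1, all later ones are X^i w^(j) with j <= i and read indices at most k. *)
Lemma sym_square_odeE (R : comNzRingType) (C ab : R) (w : {poly R}) :
  let K := 2 * C + 4 * ab + 4 * C * (2 * C - 1) in
  sym_square_ode C ab w =
    'X^2 * w^`()^`()^`() + (3 * C)%:P * ('X^1 * w^`()^`())
    + (C * (2 * C - 1))%:P * w^`()
    + (- 2%:P * ('X^3 * w^`()^`()^`()) + 'X^4 * w^`()^`()^`()
       - (9 * C)%:P * ('X^2 * w^`()^`()) + (6 * C)%:P * ('X^3 * w^`()^`())
       - K%:P * ('X^1 * w^`()) + K%:P * ('X^2 * w^`())
       + (2 * (1 - 2 * C) * ab)%:P * w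
       - (4 * (1 - 2 * C) * ab)%:P * ('X^1 * w)).
Proof.
rewrite /sym_square_ode /= !(derivM, derivB, derivD, derivN, derivX, derivC).
rewrite !(polyC_natr, polyCM, polyCB, polyCD, polyCN, polyC1).
move: (w^`()) (w^`()^`()) (w^`()^`()^`()) (C%:P) (ab%:P) 'X => w1 w2 w3 c d x.
by ring.
Qed.

Lemma coefXn_deriv_eq0 (R : comNzRingType) (w : {poly R}) i j k :
  (forall l, (l <= k)%N -> w`_l = 0) -> (j <= i)%N -> ('X^i * w^`(j))`_k = 0.
Proof.
move=> w0 ji; rewrite coefXnM; case: ltnP => // ik.
by rewrite coef_derivn w0 ?mul0rn //; lia.
Qed.

Lemma coefX_deriv2 (R : comNzRingType) (w : {poly R}) k :
  ('X^1 * w^`()^`())`_k = k%:R * (k.+1%:R * w`_k.+1).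
Proof.
rewrite coefXnM !coef_deriv.
by case: k => [|k]; rewrite ?mul0r // subn1 !mulr_natl.
Qed.

Lemma coefX2_deriv3 (R : comNzRingType) (w : {poly R}) k :
  ('X^2 * w^`()^`()^`())`_k = (k%:R - 1) * (k%:R * (k.+1%:R * w`_k.+1)).
Proof.
rewrite coefXnM !coef_deriv.
case: k => [|[|k]]; rewrite ?subrr ?mul0r ?mulr0 // subn2 /=.
by rewrite -(natrB _ (isT : 1 <= k.+2)%N) subn1 !mulr_natl.
Qed.

Lemma coefX_deriv1 (R : comNzRingType) (w : {poly R}) k :
  ('X^1 * w^`())`_k = k%:R * w`_k.
Proof.
rewrite coefXnM coef_deriv.
by case: k => [|k]; rewrite ?mul0r // subn1 mulr_natl.
Qed.

Lemma coefX2_deriv2 (R : comNzRingType) (w : {poly R}) k :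
  ('X^2 * w^`()^`())`_k = (k%:R - 1) * (k%:R * w`_k).
Proof.
rewrite coefXnM !coef_deriv.
case: k => [|[|k]]; rewrite ?subrr ?mul0r ?mulr0 // subn2 /=.
by rewrite -(natrB _ (isT : 1 <= k.+2)%N) subn1 !mulr_natl.
Qed.

Lemma coefX3_deriv3 (R : comNzRingType) (w : {poly R}) k :
  ('X^3 * w^`()^`()^`())`_k = (k%:R - 2) * ((k%:R - 1) * (k%:R * w`_k)).
Proof.
rewrite coefXnM !coef_deriv.
case: k => [|[|[|k]]]; rewrite ?subrr ?mul0r ?mulr0 ?mul0r // !subSS subn0 /=.
rewrite -(natrB _ (isT : 1 <= k.+3)%N) -(natrB _ (isT : 2 <= k.+3)%N).
by rewrite subn1 subn2 !mulr_natl.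
Qed.

(** The surviving factor is the indicial polynomial r (r - 1 + C) (r - 2 + 2C) of the equation at 0,
    for the exponent r = k + 1. *)
Lemma coef_sym_square_ode (R : comNzRingType) (C ab : R) (w : {poly R}) k :
  (forall l, (l <= k)%N -> w`_l = 0) ->
  (sym_square_ode C ab w)`_k =
    k.+1%:R * (k%:R + C) * (k%:R + 2 * C - 1) * w`_k.+1.
Proof.
move=> w0; rewrite sym_square_odeE.
have z i j : (j <= i)%N -> ('X^i * w^`(j))`_k = 0 by exact: coefXn_deriv_eq0.
have z0 i : ('X^i * w)`_k = 0 by exact: (z i 0%N).
have z1 i : (0 < i)%N -> ('X^i * w^`())`_k = 0 by exact: (z i 1%N).
have z2 i : (1 < i)%N -> ('X^i * w^`()^`())`_k = 0 by exact: (z i 2%N).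
have z3 i : (2 < i)%N -> ('X^i * w^`()^`()^`())`_k = 0 by exact: (z i 3%N).
rewrite coefD [X in _ + X](_ : _ = 0); last first.
  rewrite !(coefD, coefN, coefB) -!mulNr -?polyCN !coefCM.
  by rewrite !z0 !z1 // !z2 // !z3 // w0 //; ring.
rewrite addr0 !coefD !coefCM coefX_deriv2 coefX2_deriv3 coef_deriv -mulr_natl.
by ring.
Qed.

(** A solution is determined by its constant term as long as the indicial factor can be cancelled.
    Regularity is the right condition over dual numbers, which have zero divisors; the bound [N] is
    there because in characteristic p the factor vanishes at k + 1 = p. *)
Lemma sym_square_ode_inj (R : comNzRingType) (C ab : R) (u v : {poly R}) N :
  (size u <= N)%N -> (size v <= N)%N ->
  (forall k, (k.+1 < N)%N ->
     GRing.lreg (k.+1%:R * (k%:R + C) * (k%:R + 2 * C - 1))) ->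
  sym_square_ode C ab u = 0 -> sym_square_ode C ab v = 0 ->
  u`_0 = v`_0 -> u = v.
Proof.
move=> szu szv reg ou ov uv0.
have o : sym_square_ode C ab (u - v) = 0.
  have -> : sym_square_ode C ab (u - v) =
            sym_square_ode C ab u - sym_square_ode C ab v.
    by rewrite !sym_square_odeE !derivB; ring.
  by rewrite ou ov subrr.
suff w0 k l : (l <= k)%N -> (u - v)`_l = 0.
  by apply/polyP => k; apply/eqP; rewrite -subr_eq0 -coefB (w0 k).
elim: k l => [|k IHk] l.
  by rewrite leqn0 => /eqP ->; rewrite coefB uv0 subrr.
rewrite leq_eqVlt ltnS => /predU1P[-> | /IHk //].
have [kN | Nk] := ltnP k.+1 N; last first.
  by rewrite coefB !nth_default ?subrr //; [exact: leq_trans Nk|exact: leq_trans Nk].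
apply: (reg _ kN); rewrite mulr0 -(coef_sym_square_ode C ab) //.
by rewrite o coef0.
Qed.

Section Clausen.
Variables (R : comNzRingType) (A B C : R).
Hypothesis ABC : A + B + 1 = 2 * C.
Variables (n N : nat) (g f : nat -> R).
Hypothesis g_gt : forall k, (n < k)%N -> g k = 0.
Hypothesis f_gt : forall k, (n < k)%N -> f k = 0.
Hypothesis f0 : f 0%N = g 0%N ^+ 2.
Hypothesis g_rec : forall k,
  k.+1%:R * (k%:R + C) * g k.+1 = (k%:R + A) * (k%:R + B) * g k.
Hypothesis f_rec : forall k,
  k.+1%:R * (k%:R + C) * (k%:R + 2 * C - 1) * f k.+1 =
  (k%:R + A) * (k%:R + B) * (4 * k%:R + 4 * C - 2) * f k.

Let G := \poly_(k < n.+1) g k.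
Let P := \poly_(k < n.+1) f k.

Let coefG k : G`_k = g k.
Proof. by rewrite coef_poly; case: ltnP => // /g_gt. Qed.
Let coefP k : P`_k = f k.
Proof. by rewrite coef_poly; case: ltnP => // /f_gt. Qed.

Let ode_G : 'X * (1 - 'X) * G^`()^`() =
  (A * B)%:P * G - C%:P * ('X * (1 - 'X))^`() * G^`().
Proof.
apply/eqP; rewrite -subr_eq0; apply/eqP.
have -> : 'X * (1 - 'X) * G^`()^`() -
    ((A * B)%:P * G - C%:P * ('X * (1 - 'X))^`() * G^`()) =
  'X^1 * G^`()^`() - 'X^2 * G^`()^`() + C%:P * G^`() -
  (2 * C)%:P * ('X^1 * G^`()) - (A * B)%:P * G.
  by rewrite derivM derivB derivX derivC !polyCM polyC_natr; ring.
apply/polyP => k; rewrite !(coefB, coefD, coefCM).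
rewrite coefX_deriv2 coefX2_deriv2 coefX_deriv1 coef_deriv !coefG coef0 -ABC.
rewrite -[g k.+1 *+ _]mulr_natl.
have /eqP := g_rec k; rewrite -subr_eq0 => /eqP <-; ring.
Qed.

Let ode_P :
  'X^2 * P^`()^`()^`() + 3 * C%:P * 'X * P^`()^`()
  + C%:P * (2 * C%:P - 1) * P^`() =
  4 * 'X^3 * P^`()^`()^`() + (6 + 12 * C%:P) * 'X^2 * P^`()^`()
    + (8 * C%:P ^+ 2 + 4 * C%:P + 4 * (A * B)%:P) * 'X * P^`()
    + 2 * (2 * C%:P - 1) * (A * B)%:P * P.
Proof.
apply/eqP; rewrite -subr_eq0; apply/eqP.
transitivity ('X^2 * P^`()^`()^`() + (3 * C)%:P * ('X^1 * P^`()^`())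
  + (C * (2 * C - 1))%:P * P^`() -
  ((4%:P * ('X^3 * P^`()^`()^`()) + (6 + 12 * C)%:P * ('X^2 * P^`()^`())
    + (8 * C ^+ 2 + 4 * C + 4 * (A * B))%:P * ('X^1 * P^`())
    + (2 * (2 * C - 1) * (A * B))%:P * P))).
  by rewrite !(polyC_natr, polyCM, polyCB, polyCD, polyC_exp, polyC1); ring.
apply/polyP => k; rewrite !(coefB, coefD, coefCM).
rewrite coefX_deriv2 coefX2_deriv3 coefX3_deriv3 coefX2_deriv2 coefX_deriv1 coef_deriv.
rewrite !coefP coef0 -[f k.+1 *+ _]mulr_natl.
have /eqP := f_rec k; rewrite -subr_eq0 => /eqP <-.
have -> : A = 2 * C - 1 - B by rewrite -ABC; ring.
ring.
Qed.

Let szG : (size G <= n.+1)%N. Proof. exact: size_poly. Qed.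
Let szP : (size P <= n.+1)%N. Proof. exact: size_poly. Qed.

Hypothesis n_lt : (n + n < N)%N.
Hypothesis regN : forall k, (k.+1 < N)%N ->
  GRing.lreg (k.+1%:R * (k%:R + C) * (k%:R + 2 * C - 1)).

(** Clausen's formula after a quadratic transformation: 2F1(A, B; C; t)^2 = 3F2(A, B, (A+B)/2; C,
    A+B; 4t(1-t)), where the recurrence of [f] absorbs 4^k. Both sides solve [sym_square_ode], share
    the constant term and have size at most 2n + 1, in the range where solutions are unique. *)
Theorem clausen :
  (\poly_(k < n.+1) g k) ^+ 2 = (\poly_(k < n.+1) f k) \Po ('X * (1 - 'X)).
Proof.
have ds : ('X * (1 - 'X))^`() = 1 - 2 * 'X :> {poly R}.
  by rewrite derivM derivB derivX derivC; ring.
have dds : (1 - 2 * 'X)^`() = - 2 :> {poly R}.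
  by rewrite derivB derivM derivX -polyC_natr !derivC; ring.
rewrite -/G -/P; apply: (@sym_square_ode_inj _ C (A * B) _ _ N).
- rewrite expr2; apply: leq_trans (size_polyMleq _ _) _.
  by apply: leq_trans n_lt; rewrite -ltnS; lia.
- apply: leq_trans (size_comp_poly_leq _ _) _; apply: leq_trans n_lt.
  rewrite ltnS addnn -muln2; apply: leq_mul; first by rewrite -subn1; lia.
  have : (size ('X * (1 - 'X) : {poly R})%R <= 3)%N.
    apply: leq_trans (size_polyMleq _ _) _; rewrite size_polyX /=.
    apply: leq_trans (size_polyD _ _) _.
    by rewrite size_polyN size_polyX size_poly1.
  by rewrite -subn1; lia.
- exact: regN.
- have [e1 e2] := sym_square_identity ode_G.
  rewrite /sym_square_ode ds.
  have -> : 'X * (1 - 'X) * (G ^+ 2)^`()^`() + C%:P * (1 - 2 * 'X) * (G ^+ 2)^`()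
      - 2 * (A * B)%:P * G ^+ 2 = 2 * ('X * (1 - 'X)) * G^`() ^+ 2.
    by rewrite -e1 ds expr2 !derivM !derivD !derivM; ring.
  rewrite -[RHS]e2 !(ds, expr2, derivM) -polyC_natr derivC polyC_natr; ring.
- have := congr1 (comp_poly ('X * (1 - 'X))) ode_P.
  rewrite !(rmorph_nat, rmorph1, rmorphXn, rmorphM, rmorphD, rmorphN) /=.
  rewrite !(comp_polyC, comp_polyX).
  have ts : (1 - 2 * 'X) ^+ 2 = 1 - 4 * ('X * (1 - 'X)) :> {poly R} by ring.
  have d2 : 2^`() = 0 :> {poly R} by rewrite -polyC_natr derivC.
  rewrite /sym_square_ode polyCM.
  move: ds dds; set S := 'X * (1 - 'X) in ts *; set T := 1 - 2 * 'X in ts *.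
  clearbody S T => dS dT eP.
  rewrite -[RHS](clausen_identity ts eP).
  by rewrite !(derivM, derivD, derivN, deriv_comp, dS, dT, derivC, d2); ring.
- by rewrite -!horner_coef0 horner_exp horner_comp !hornerE !horner_coef0 coefG coefP f0.
Qed.
End Clausen.

(** * Evaluation at t = -1 in characteristic p *)

(** At t = -1 the inner polynomial t(1-t) is -2 and its derivative 1 - 2t is 3. The second equation
    is the chain rule times -2, so that both sides apply x d/dx, which weights the k-th term by
    k. *)
Lemma clausen_at_m1 (R : comNzRingType) (G P : {poly R}) :
  G ^+ 2 = P \Po ('X * (1 - 'X)) ->
  G.[-1] ^+ 2 = P.[-2] /\
  3 * (-2 * P^`().[-2]) = 4 * G.[-1] * (-1 * G^`().[-1]).
Proof.
move=> GP; have m2 : -1 * (1 - -1) = -2 :> R by ring.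
split.
  rewrite -horner_exp GP horner_comp hornerM hornerD hornerN hornerX.
  by rewrite hornerC m2.
have := congr1 (fun q : {poly _} => q^`().[-1]) GP.
rewrite expr2 deriv_comp !derivM derivB derivX derivC sub0r mul1r.
rewrite !(hornerD, hornerM, horner_comp, hornerN, hornerX, hornerC) m2.
move: (P^`().[-2]) (G.[-1]) (G^`().[-1]) => a b d e.
transitivity (-2 * (a * (1 - -1 + -1 * -1))); first by ring.
by rewrite -e; ring.
Qed.

Section HalfPrime.
Variables (F : fieldType) (p n : nat).
Hypothesis pF : p \in [pchar F].
Hypothesis pE : p = n.*2.+1.

Lemma natr_neq0 k : (0 < k < p)%N -> k%:R != 0 :> F.
Proof.
by case/andP=> k0 kp; rewrite -(dvdn_pcharf pF) gtnNdvd.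
Qed.

Lemma natr_inj i j : (i < p)%N -> (j < p)%N -> i%:R = j%:R :> F -> i = j.
Proof.
wlog ij : i j / (i <= j)%N => [hw ip jp e|ip jp /eqP].
  by have [ij|/ltnW ji] := leqP i j; [apply: hw|apply/esym/hw].
rewrite eq_sym -subr_eq0 -natrB // -(dvdn_pcharf pF) => d.
apply/eqP; rewrite eqn_leq ij /= -subn_eq0; apply: contraLR d => d0.
by rewrite gtnNdvd ?lt0n //; lia.
Qed.

Lemma n_double : n%:R = - 2^-1 :> F.
Proof.
have p0 : (n.*2.+1)%:R = 0 :> F by rewrite -pE pcharf0.
have n0 : (0 < n)%N by have := prime_gt1 (pcharf_prime pF); rewrite pE; case: (n).
have two : 2%:R != 0 :> F by apply: natr_neq0; rewrite pE; lia.
apply: (mulfI two); rewrite mulrN divff //; apply/eqP.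
by rewrite -subr_eq0 opprK -natrM mul2n natr1 p0.
Qed.

Lemma n_gt0 : (0 < n)%N.
Proof. by have := prime_gt1 (pcharf_prime pF); rewrite pE; case: (n). Qed.

Lemma two_neq0 : 2 != 0 :> F.
Proof. by apply: natr_neq0; have := n_gt0; rewrite pE; lia. Qed.

Definition harm k : F := \sum_(1 <= j < k.+1) j%:R^-1.

Lemma harmS k : harm k.+1 = harm k + k.+1%:R^-1.
Proof. by rewrite /harm big_nat_recr. Qed.

Lemma harm0 : harm 0 = 0. Proof. by rewrite /harm big_geq. Qed.

Local Notation H := harm.
Local Notation c k := ('C(n, k)%:R : F).

Lemma bin_rec k : k.+1%:R * c k.+1 = - (k%:R + 2^-1) * c k.
Proof.
rewrite -natrM mul_bin_left natrM.
have [kn | nk] := leqP k n; last by rewrite bin_small // !mulr0.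
by rewrite natrB // n_double opprD addrC.
Qed.

(* Modulo p, the coefficients of 2F1(1/2, 1/2+2e; 1+e; t) and of
   3F2(1/2, 1/2+2e, 1/2+e; 1+e, 1+2e; 4t), with [1/2 = -n] and
   [H (n - k) - H n] standing for the sum of the 1/(1/2+j) for j < k. *)
Definition clausen_g k : dual F :=
  Dual (c k ^+ 2) (c k ^+ 2 * (2 * H (n - k) - 2 * H n - H k)).
Definition clausen_f k : dual F :=
  Dual ((-4) ^+ k * c k ^+ 3)
       ((-4) ^+ k * c k ^+ 3 * (3 * (H (n - k) - H n - H k))).

Let A : dual F := Dual 2^-1 0.
Let B : dual F := Dual 2^-1 2.
Let C : dual F := Dual 1 1.

(** In [F], 1/(n - k) is -1/(k + 1/2). Everything at k + 1 thus becomes rational in k and 1/2, and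
    the recurrences below reduce to field identities. *)
Lemma harm_step k : (k < n)%N ->
  [/\ k%:R + 1 != 0 :> F, k%:R + 2^-1 != 0 :> F,
      c k.+1 = - (k%:R + 2^-1) * c k / (k%:R + 1),
      H k.+1 = H k + (k%:R + 1)^-1
    & H (n - k.+1) = H (n - k) + (k%:R + 2^-1)^-1].
Proof.
move=> kn; have k0 : k%:R + 1 != 0 :> F.
  by rewrite natr1; apply: natr_neq0; rewrite pE; lia.
have y0 : k%:R + 2^-1 != 0 :> F.
  rewrite -[2^-1]opprK -n_double -opprB oppr_eq0 -natrB; last exact: ltnW.
  by apply: natr_neq0; rewrite pE; lia.
split=> //.
- by apply: (mulfI k0); rewrite [RHS]mulrC divfK // natr1 bin_rec.
- by rewrite harmS natr1.
have -> : (n - k = (n - k.+1).+1)%N by rewrite subnSK.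
rewrite harmS subnSK // natrB 1?ltnW // n_double -opprD invrN [2^-1 + _]addrC.
by rewrite subrK.
Qed.

(** For k > n the binomial is 0, and for k = n one has k = -1/2: this is where the recurrences
    stop. *)
Lemma bin_stop k : (n <= k)%N -> c k.+1 = 0 /\ k%:R * c k = - (2^-1 * c k).
Proof.
move=> nk; rewrite bin_small //; split=> //; apply/eqP.
by rewrite -subr_eq0 opprK -mulrDl -oppr_eq0 -mulNr -bin_rec bin_small ?mulr0.
Qed.

Lemma clausen_g_rec k :
  k.+1%:R * (k%:R + C) * clausen_g k.+1 = (k%:R + A) * (k%:R + B) * clausen_g k.
Proof.
have [nk | kn] := leqP n k.
  have [e1 e2] := bin_stop nk.
  apply: dual_ext; rewrite /clausen_g !dualE /= e1;
    move: e2; move: (2^-1 : F) => h e2; ring: e2.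
have [k0 y0 e1 e2 e3] := harm_step kn.
apply: dual_ext; rewrite /clausen_g !dualE /= e1 ?e2 ?e3 -natr1.
  by move: k0 y0; move: (k%:R) (c k) (2^-1 : F) => x b h k0 y0; field.
move: k0 y0; move: (k%:R) (c k) (2^-1 : F) (H k) (H n) (H (n - k)) => x b h *.
by field; apply/andP.
Qed.

Lemma clausen_f_rec k :
  k.+1%:R * (k%:R + C) * (k%:R + 2 * C - 1) * clausen_f k.+1 =
  (k%:R + A) * (k%:R + B) * (4 * k%:R + 4 * C - 2) * clausen_f k.
Proof.
have -> : 4 * k%:R + 4 * C - 2 = Dual (4 * (k%:R + 2^-1)) 4.
  by apply: dual_ext; rewrite !dualE /=; [field; exact: two_neq0 | ring].
have [nk | kn] := leqP n k.
  have [e1 e2] := bin_stop nk.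
  apply: dual_ext; rewrite /clausen_f !dualE /= e1;
    move: e2; move: (2^-1 : F) => h e2; ring: e2.
have [k0 y0 e1 e2 e3] := harm_step kn.
apply: dual_ext; rewrite /clausen_f !dualE /= e1 ?e2 ?e3 -natr1 exprS.
  by move: k0 y0; move: (k%:R) (c k) (2^-1 : F) => x b h k0 y0; field.
move: k0 y0; move: (k%:R) (c k) (2^-1 : F) (H k) (H n) (H (n - k)) => x b h *.
by field; apply/andP.
Qed.

Lemma dual_lreg (x : dual F) : dre x != 0 -> GRing.lreg x.
Proof.
move=> x0 y z e; have e1 : dre y = dre z.
  by apply: (mulfI x0); rewrite -!dreM e.
apply: dual_ext => //; apply: (mulfI x0); apply: (addIr (deps x * dre y)).
by rewrite -depsM e depsM e1.
Qed.

Lemma clausen_eval :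
  let G := \poly_(k < n.+1) clausen_g k in
  let P := \poly_(k < n.+1) clausen_f k in
  G ^+ 2 = P \Po ('X * (1 - 'X)).
Proof.
apply: (@clausen _ A B C _ n p).
- by apply: dual_ext; rewrite !dualE /=; [field; exact: two_neq0 | ring].
- by move=> k nk; apply: dual_ext; rewrite /= bin_small // ?expr0n ?mul0r.
- move=> k nk; apply: dual_ext; rewrite /= bin_small // ?expr0n /=; ring.
- by rewrite /clausen_f /clausen_g subn0 bin0 !expr1n; apply: dual_ext;
    rewrite expr2 !dualE /= ?harm0; ring.
- exact: clausen_g_rec.
- exact: clausen_f_rec.
- by rewrite pE; lia.
move=> k kp; apply: dual_lreg; rewrite !dualE /= -natr1.
have k0 : k%:R + 1 != 0 :> F by rewrite natr1 natr_neq0.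
by rewrite mulr1 -[2]/(1 + 1) addrA addrK !mulf_neq0.
Qed.

Lemma horner_theta (R : comNzRingType) m (e : nat -> R) x :
  x * (\poly_(k < m) e k)^`().[x] = \sum_(k < m) k%:R * (e k * x ^+ k).
Proof.
have -> : \sum_(k < m) k%:R * (e k * x ^+ k) = (\poly_(k < m) (k%:R * e k)).[x].
  by rewrite horner_poly; apply: eq_bigr => k _; rewrite mulrA.
have -> : \poly_(k < m) (k%:R * e k) = 'X^1 * (\poly_(k < m) e k)^`().
  apply/polyP => k; rewrite coefX_deriv1 !coef_poly.
  by case: ifP; rewrite ?mulr0.
by rewrite hornerM hornerX.
Qed.

Definition alt k : F := (-1) ^+ k * c k ^+ 2.
Definition lam k : F := 2 * H (n - k) - 2 * H n - H k.

(* This is [H (2 * k) - H k]; see [hdiffE]. *)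
Definition hdiff k : F := (H (n - k) - H n - H k) / 2.

Lemma dual_intr_exp (z : int) k : (z%:~R : dual F) ^+ k = Dual (z%:~R ^+ k) 0.
Proof.
elim: k => [|k IHk]; first exact: dual_ext.
have re m : dre (m%:~R : dual F) = m%:~R.
  by case: m => m; rewrite ?NegzE ?mulrNz ?dreN dre_nat.
have im m : deps (m%:~R : dual F) = 0.
  by case: m => m; rewrite ?NegzE ?mulrNz ?depsN deps_nat ?oppr0.
by rewrite exprS IHk; apply: dual_ext; rewrite !dualE ?re ?im /= ?exprS; ring.
Qed.

Lemma clausen_g_eval k : clausen_g k * (-1) ^+ k = Dual (alt k) (alt k * lam k).
Proof.
rewrite -[-1]/((-1)%:~R) dual_intr_exp -[(-1)%:~R]/(-1).
by apply: dual_ext; rewrite !dualE /= /alt /lam; ring.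
Qed.

Definition cub k : F := 8 ^+ k * c k ^+ 3.

Lemma clausen_f_eval k :
  clausen_f k * (-2) ^+ k = Dual (cub k) (6 * (cub k * hdiff k)).
Proof.
rewrite -[-2]/((-2)%:~R) dual_intr_exp -[(-2)%:~R]/(-2).
have e8 : 8 ^+ k = (-4) ^+ k * (-2) ^+ k :> F by rewrite -exprMn; congr (_ ^+ _); ring.
apply: dual_ext; rewrite !dualE /= /cub /hdiff e8; first ring.
by field; exact: two_neq0.
Qed.

(** These are the real parts and e-parts of the two equations of [clausen_at_m1]. The 6 is the
    e-weight of the 3F2, since 3 (H (n - k) - H n - H k) is 6 [hdiff]; 18 multiplies it by the 3 of
    the chain rule. *)
Theorem clausen_values :
  let S (w : nat -> F) := \sum_(k < n.+1) w k in
  let s0 := S alt in let s1 := S (fun k => alt k * lam k) in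
  let t0 := S (fun k => k%:R * alt k) in
  let t1 := S (fun k => k%:R * (alt k * lam k)) in
  [/\ S cub = s0 ^+ 2,
      6 * S (fun k => cub k * hdiff k) = 2 * s0 * s1,
      3 * S (fun k => k%:R * cub k) = 4 * s0 * t0
    & 18 * S (fun k => k%:R * (cub k * hdiff k)) = 4 * (s0 * t1 + s1 * t0)].
Proof.
move=> S s0 s1 t0 t1; have GP := clausen_eval.
set G := \poly_(k < _) _ in GP; set P := \poly_(k < _) _ in GP.
have Gv : G.[-1] = Dual s0 s1.
  rewrite horner_poly (eq_bigr _ (fun k _ => clausen_g_eval _)).
  by apply: dual_ext; rewrite ?dre_sum ?deps_sum.
have Pv : P.[-2] = Dual (S cub) (6 * S (fun k => cub k * hdiff k)).
  rewrite horner_poly (eq_bigr _ (fun k _ => clausen_f_eval _)) /S big_distrr.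
  by apply: dual_ext; rewrite ?dre_sum ?deps_sum.
have Gt : -1 * G^`().[-1] = Dual t0 t1.
  rewrite horner_theta; apply: dual_ext; rewrite ?dre_sum ?deps_sum;
    by apply: eq_bigr => k _; rewrite clausen_g_eval !dualE /=; ring.
have Pt : -2 * P^`().[-2] = Dual (S (fun k => k%:R * cub k))
                        (6 * S (fun k => k%:R * (cub k * hdiff k))).
  rewrite horner_theta /S big_distrr; apply: dual_ext; rewrite ?dre_sum ?deps_sum;
    by apply: eq_bigr => k _; rewrite clausen_f_eval !dualE /=; ring.
have [] := clausen_at_m1 GP; rewrite Gt Gv Pv Pt => e1 e2.
split.
- by have := congr1 (@dre F) e1; rewrite expr2 !dualE.
- by have := congr1 (@deps F) e1; rewrite expr2 !dualE /= => <-; ring.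
- by have := congr1 (@dre F) e2; rewrite !dualE.
have := congr1 (@deps F) e2; rewrite !dualE /= => e.
transitivity (4 * s0 * t1 + (4 * s1 + 0 * s0) * t0); last by ring.
by rewrite -e; ring.
Qed.
End HalfPrime.

(** * The Wronskian of the equation of 2F1(1/2, 1/2; 1; t) *)

Definition theta (R : comNzRingType) (w : {poly R}) := 'X^1 * w^`().

Lemma coef_theta (R : comNzRingType) (w : {poly R}) k :
  (theta w)`_k = k%:R * w`_k.
Proof. exact: coefX_deriv1. Qed.

Section Wronskian.
Variables (F : fieldType) (p n : nat).
Hypothesis pF : p \in [pchar F].
Hypothesis pE : p = n.*2.+1.

Local Notation H := (harm F).
Local Notation c k := ('C(n, k)%:R : F).

(* [G] and [G log t + K] are the solutions at t = 0 of the equation of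
   2F1(1/2, 1/2; 1; t). *)
Let G := \poly_(k < n.+1) c k ^+ 2.
Let K := \poly_(k < n.+1) (c k ^+ 2 * (4 * hdiff F n k)).

Let coefG k : G`_k = c k ^+ 2.
Proof. by rewrite coef_poly; case: ltnP => // nk; rewrite bin_small // expr0n. Qed.
Let coefK k : K`_k = c k ^+ 2 * (4 * hdiff F n k).
Proof.
by rewrite coef_poly; case: ltnP => // nk; rewrite bin_small // expr0n mul0r.
Qed.

Let shift_sqr (x b d : F) :
  x * (x * (b ^+ 2 * d)) + x * (b ^+ 2 * d) + 2^-1 ^+ 2 * (b ^+ 2 * d) +
    2 * (x * b ^+ 2) + b ^+ 2 =
  ((x + 2^-1) * b) ^+ 2 * d + 2 * ((x + 2^-1) * b) * b.
Proof. by field; exact: two_neq0 pF pE. Qed.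

Let bin_stop' k : (n <= k)%N -> (k%:R + 2^-1) * c k = 0.
Proof. by move=> nk; have [_ e] := bin_stop pF pE nk; rewrite mulrDl e addNr. Qed.

Let ode_G : theta (theta G) = 'X * (theta (theta G) + theta G + (2^-1 ^+ 2)%:P * G).
Proof.
apply/polyP => -[|k]; rewrite coef_theta coefXM /= ?mul0r //.
rewrite !coefD coefCM !coef_theta !coefG.
transitivity (((k%:R + 2^-1) * c k) ^+ 2); last first.
  by field; exact: two_neq0 pF pE.
have [nk | kn] := leqP n k.
  by rewrite bin_stop' // bin_small // !expr0n !mulr0.
have [k0 y0 -> _ _] := harm_step pF pE kn.
move: k0 y0; rewrite -[k.+1%:R]natr1.
by move: (k%:R) (c k) (2^-1 : F) => x b h k0 y0; field.
Qed.

(** These are the terms free of log t in theta^2 y = t (theta + 1/2)^2 y for y = G log t + K; those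
    with log t are [ode_G]. As in Frobenius' method, the weights in [K] are the logarithmic
    derivatives at r = 0 of ((1/2 + r)_k / (1 + r)_k)^2. *)
Let ode_K : theta (theta K) + 2 * theta G =
  'X * (theta (theta K) + theta K + (2^-1 ^+ 2)%:P * K + 2 * theta G + G).
Proof.
apply/polyP => -[|k].
  by rewrite coefD coefXM -polyC_natr coefCM !coef_theta !mul0r mulr0 addr0.
rewrite coefXM /= -!polyC_natr !coefD !coefCM !coef_theta !coefG !coefK.
rewrite shift_sqr.
have [nk | kn] := leqP n k.
  by rewrite bin_stop' // bin_small // !expr0n /= !mul0r !mulr0 !mul0r addr0.
have [k0 y0 -> e2 e3] := harm_step pF pE kn.
have e4 : 4 * hdiff F n k.+1 =
    4 * hdiff F n k + 2 * ((k%:R + 2^-1)^-1 - (k%:R + 1)^-1).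
  rewrite /hdiff e2 e3; move: ((k%:R + 2^-1)^-1 : F) ((k%:R + 1)^-1 : F) => u v.
  by field; exact: two_neq0 pF pE.
rewrite e4; move: k0 y0; rewrite -[k.+1%:R]natr1.
move: (4 * hdiff F n k) (k%:R : F) (c k) (2^-1 : F) => d x b h k0 y0.
by field; apply/andP.
Qed.

(** This is G theta(y) - y theta(G) for y = G log t + K; log t cancels. *)
Let W := G ^+ 2 + G * theta K - K * theta G.

Let theta_W : theta ((1 - 'X) * W) = 0.
Proof.
have thM (u v : {poly F}) : theta (u * v) = theta u * v + u * theta v.
  by rewrite /theta derivM; ring.
have thD (u v : {poly F}) : theta (u + v) = theta u + theta v.
  by rewrite /theta derivD; ring.
have thN (u : {poly F}) : theta (- u) = - theta u.
  by rewrite /theta derivN; ring.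
have th1 : theta (1 - 'X) = - 'X :> {poly F} by rewrite /theta derivB derivC derivX; ring.
have e1 : (1 - 'X) * theta (theta G) = 'X * (theta G + (2^-1 ^+ 2)%:P * G).
  by rewrite mulrBl mul1r {1}ode_G; ring.
have e2 : (1 - 'X) * theta (theta K) =
    'X * (theta K + (2^-1 ^+ 2)%:P * K + 2 * theta G + G) - 2 * theta G.
  have -> : (1 - 'X) * theta (theta K) =
    theta (theta K) + 2 * theta G - 2 * theta G - 'X * theta (theta K) by ring.
  by rewrite ode_K; ring.
rewrite (thM _ W) th1 /W !thD thN (thM G (theta K)) (thM K (theta G)) (thM G G).
transitivity (- 'X * (G ^+ 2 + G * theta K - K * theta G)
   + 2 * (1 - 'X) * (G * theta G) + G * ((1 - 'X) * theta (theta K))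
   - K * ((1 - 'X) * theta (theta G))); first by ring.
by rewrite e1 e2; ring.
Qed.

Let sz_theta (u : {poly F}) : (size u <= n.+1)%N -> (size (theta u) <= n.+1)%N.
Proof.
move=> su; apply/leq_sizeP => k nk.
by rewrite coef_theta nth_default ?mulr0 //; apply: leq_trans nk.
Qed.

Let szW : (size W <= p)%N.
Proof.
have sG : (size G <= n.+1)%N by apply: size_poly.
have sK : (size K <= n.+1)%N by apply: size_poly.
have sM (u v : {poly F}) : (size u <= n.+1)%N -> (size v <= n.+1)%N ->
    (size (u * v)%R <= p)%N.
  by move=> su sv; apply: leq_trans (size_polyMleq _ _) _; rewrite pE -subn1; lia.
rewrite /W; apply: leq_trans (size_polyD _ _) _; rewrite size_polyN geq_max.
rewrite (leq_trans (size_polyD _ _)) ?geq_max /=; last by rewrite expr2 !sM ?sz_theta.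
by rewrite sM ?sz_theta.
Qed.

(** theta V = 0 leaves only exponents divisible by p, and V = (1 - t) W has degree at most p. The
    constant term 1 and the root t = 1 force V = 1 - t^p, whose value at -1 is 2, that is, twice
    W(-1). *)
Let W_m1 : W.[-1] = 1.
Proof.
set V := (1 - 'X) * W.
have V0 : V`_0 = 1.
  rewrite -horner_coef0 /V /W !(hornerD, hornerM, hornerN, hornerX, hornerC, expr2).
  by rewrite !mul0r !mulr0 horner_coef0 coefG bin0 expr1n; ring.
have Vk k : (k != 0)%N -> (k != p)%N -> V`_k = 0.
  move=> k0 kp; have [pk | kp'] := ltnP p k.
    rewrite nth_default //; apply: leq_trans (size_polyMleq _ _) _.
    apply: leq_trans pk; rewrite -subn1.
    have : (size (1 - 'X : {poly F})%R <= 2)%N.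
      by rewrite -size_polyN opprB size_XsubC.
    by move=> s1; rewrite leq_subLR (leq_trans (leq_add s1 szW)).
  have := congr1 (fun u : {poly F} => u`_k) theta_W.
  rewrite -/V coef_theta coef0 => /eqP; rewrite mulf_eq0 => /orP[|/eqP //].
  by rewrite (negPf (natr_neq0 pF _)) //; lia.
have VE x : V.[x] = 1 + V`_p * x ^+ p.
  have sV : (size V <= p.+1)%N.
    by apply/leq_sizeP => k pk; apply: Vk; lia.
  rewrite (horner_coef_wide _ sV) big_ord_recr /=; congr (_ + _).
  rewrite pE big_ord_recl V0 mul1r expr0 big1 ?addr0 // => k _.
  by rewrite Vk ?mul0r //= pE /bump /=; have := ltn_ord k; lia.
have V1 : V.[1] = 0 by rewrite hornerM hornerD hornerN hornerX hornerC subrr mul0r.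
have Vp : V`_p = -1.
  by apply: (addrI 1); rewrite subrr -[RHS]V1 VE expr1n mulr1.
have : V.[-1] = 2.
  by rewrite VE Vp -signr_odd pE /= odd_double /= expr1; ring.
rewrite hornerM hornerD hornerN hornerX hornerC opprK => e.
by apply: (mulfI (two_neq0 pF pE)); rewrite mulr1 -[RHS]e.
Qed.

Lemma wronskian :
  let S (w : nat -> F) := \sum_(k < n.+1) w k in
  S (alt F n) ^+ 2
  + S (alt F n) * S (fun k => k%:R * (alt F n k * (4 * hdiff F n k)))
  - S (fun k => alt F n k * (4 * hdiff F n k)) * S (fun k => k%:R * alt F n k) = 1.
Proof.
move=> S; rewrite -[RHS]W_m1 /W.
have eG k : c k ^+ 2 * (-1) ^+ k = alt F n k by rewrite mulrC.
have eK k : c k ^+ 2 * (4 * hdiff F n k) * (-1) ^+ k =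
    alt F n k * (4 * hdiff F n k) by rewrite -eG mulrAC.
have th (u : {poly F}) : (theta u).[-1] = -1 * u^`().[-1] by rewrite hornerM hornerX.
rewrite !(th, hornerD, hornerM, hornerN, horner_exp) /G /K !horner_theta !horner_poly.
rewrite /S; congr (_ ^+ 2 + _ * _ - _ * _); by apply: eq_bigr => k _; rewrite ?eG ?eK.
Qed.
End Wronskian.

(** * Reversal of the sums and elimination of the unknowns *)

Section Symmetry.
Variables (F : fieldType) (p n : nat).
Hypothesis pF : p \in [pchar F].
Hypothesis pE : p = n.*2.+1.

Local Notation H := (harm F).
Local Notation c k := ('C(n, k)%:R : F).
Local Notation alt := (alt F n).
Local Notation hdiff := (hdiff F n).
Local Notation cub := (cub F n).
Let S (w : nat -> F) := \sum_(k < n.+1) w k.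

Lemma sum_rev (w : nat -> F) : S w = S (fun k => w (n - k)%N).
Proof.
rewrite /S (reindex_inj rev_ord_inj) /=; apply: eq_bigr => k _.
by rewrite subSS.
Qed.

Lemma alt_rev k : (k <= n)%N -> alt (n - k) = (-1) ^+ n * alt k.
Proof.
move=> kn; rewrite /alt bin_sub // mulrA; congr (_ * _).
by rewrite -[LHS]signr_odd -[in RHS]signr_odd -[X in _ = _ * X]signr_odd oddB // signr_addb.
Qed.

Let s0 := S alt.
Let t0 := S (fun k => k%:R * alt k).
Let sh := S (fun k => alt k * H k).
Let th := S (fun k => k%:R * (alt k * H k)).
Let e : F := (-1) ^+ n.

Let s0_rev : s0 = e * s0.
Proof.
rewrite {1}/s0 sum_rev /s0 /S big_distrr; apply: eq_bigr => k _.
by rewrite alt_rev // -ltnS.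
Qed.

Let t0_rev : t0 = e * (n%:R * s0 - t0).
Proof.
rewrite {1}/t0 sum_rev /t0 /s0 /S big_distrr -sumrB big_distrr; apply: eq_bigr => k _.
by rewrite alt_rev 1?natrB -1?ltnS // /e /=; ring.
Qed.

Let sh_rev : S (fun k => alt k * H (n - k)) = e * sh.
Proof.
rewrite sum_rev /sh /S big_distrr; apply: eq_bigr => k _.
by rewrite alt_rev 1?subKn -1?ltnS // /e /=; ring.
Qed.

Let th_rev : S (fun k => k%:R * (alt k * H (n - k))) = e * (n%:R * sh - th).
Proof.
rewrite sum_rev /sh /th /S big_distrr -sumrB big_distrr; apply: eq_bigr => k _.
by rewrite alt_rev 1?natrB 1?subKn -1?ltnS // /e /=; ring.
Qed.

Let s1E : S (fun k => alt k * lam F n k) = 2 * (e * sh) - 2 * H n * s0 - sh.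
Proof.
rewrite -sh_rev /sh /s0 /S /lam; move: (H n) => hn.
by rewrite !big_distrr -!sumrB; apply: eq_bigr => k _ /=; ring.
Qed.

Let t1E : S (fun k => k%:R * (alt k * lam F n k)) =
  2 * (e * (n%:R * sh - th)) - 2 * H n * t0 - th.
Proof.
rewrite -th_rev /th /t0 /S /lam; move: (H n) => hn.
by rewrite !big_distrr -!sumrB; apply: eq_bigr => k _ /=; ring.
Qed.

Let hdiff4 k : 4 * hdiff k = 2 * (H (n - k) - H n - H k).
Proof. by rewrite /hdiff; field; exact: two_neq0 pF pE. Qed.

Let s2E : S (fun k => alt k * (4 * hdiff k)) = 2 * (e * sh - H n * s0 - sh).
Proof.
rewrite -sh_rev /sh /s0 /S.
under eq_bigr => k _ do rewrite hdiff4.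
move: (H n) => hn.
by rewrite !big_distrr -!sumrB big_distrr; apply: eq_bigr => k _ /=; ring.
Qed.

Let t2E : S (fun k => k%:R * (alt k * (4 * hdiff k))) =
  2 * (e * (n%:R * sh - th) - H n * t0 - th).
Proof.
rewrite -th_rev /th /t0 /S; under eq_bigr => k _ do rewrite hdiff4.
move: (H n) => hn.
by rewrite !big_distrr -!sumrB big_distrr; apply: eq_bigr => k _ /=; ring.
Qed.

Let m2n : 2 * n%:R = -1 :> F.
Proof. by rewrite (n_double pF pE) mulrN divff // (two_neq0 pF pE). Qed.

Let wronskian' : s0 ^+ 2 + s0 * (2 * (e * (n%:R * sh - th) - H n * t0 - th))
  - 2 * (e * sh - H n * s0 - sh) * t0 = 1.
Proof. by rewrite -s2E -t2E; exact: (wronskian pF pE). Qed.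

Let A0 := S cub.
Let A1 := S (fun k => k%:R * cub k).
Let B0 := S (fun k => cub k * hdiff k).
Let B1 := S (fun k => k%:R * (cub k * hdiff k)).

Let values :
  let s1 := 2 * (e * sh) - 2 * H n * s0 - sh in
  let t1 := 2 * (e * (n%:R * sh - th)) - 2 * H n * t0 - th in
  [/\ A0 = s0 ^+ 2, 6 * B0 = 2 * s0 * s1, 3 * A1 = 4 * s0 * t0
    & 18 * B1 = 4 * (s0 * t1 + s1 * t0)].
Proof. by move=> s1 t1; rewrite /s1 /t1 -s1E -t1E; exact: (clausen_values pF pE). Qed.

(** Reversal gives t0 = -s0/4 because n = -1/2. The combination of the last equation is 3 times the
    Wronskian, which removes s0 [th]; [sh] survives in [B0], as reversal puts no constraint on it
    for even n. *)
Lemma harmonic_relations_even : ~~ odd n ->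
  [/\ A0 = s0 ^+ 2, 3 * B0 = s0 * (sh - 2 * H n * s0), 3 * A1 + A0 = 0
    & 18 * B1 + 6 * B0 + 3 * A0 = 3].
Proof.
move=> en; have e1 : e = 1 by rewrite /e -signr_odd (negPf en).
have [] := values; rewrite e1 => a0 b0 a1 b1.
have t0E : 4 * t0 = - s0.
  have := t0_rev; rewrite e1 mul1r => t0E.
  transitivity (2 * (n%:R * s0 - t0 + t0)); first by rewrite -[in RHS]t0E; ring.
  by rewrite subrK mulrA m2n mulN1r.
have two := two_neq0 pF pE.
split=> //.
- apply: (mulfI two); transitivity (6 * B0); first by ring.
  by rewrite b0; ring.
- rewrite a1 a0; transitivity (s0 * (4 * t0) + s0 ^+ 2); first by ring.
  by rewrite t0E; ring.
have w := wronskian'; rewrite e1 in w; rewrite b1 b0 a0 -[RHS]mulr1 -[X in _ = _ * X]w.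
have four : 4 != 0 :> F by rewrite -[4]/((2 * 2)%:R) natrM mulf_neq0.
have -> : t0 = - s0 / 4 by rewrite -t0E mulrAC divff ?mul1r.
by rewrite (n_double pF pE); field; rewrite four.
Qed.

(** Reversal forces s0 = 0. The Wronskian then reads 4 sh t0 = 1, while 18 B1 = -12 sh t0. *)
Lemma harmonic_relations_odd : (3 < p)%N -> odd n ->
  [/\ A0 = 0, B0 = 0, 3 * A1 + A0 = 0 & 18 * B1 + 6 * B0 + 3 * A0 = -3].
Proof.
move=> p_gt3 on; have e1 : e = -1 by rewrite /e -signr_odd on.
have [] := values; rewrite e1 => a0 b0 a1 b1.
have two := two_neq0 pF pE.
have s00 : s0 = 0.
  apply: (mulfI two); have := s0_rev; rewrite e1 mulN1r mulr0 => h.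
  by rewrite mulr_natl mulr2n {1}h addNr.
have w := wronskian'; rewrite e1 s00 in w.
rewrite s00 in a0 b0 a1 b1.
have six : 6 != 0 :> F.
  by rewrite -[6]/((2 * 3)%:R) natrM mulf_neq0 //; apply: (natr_neq0 pF); rewrite p_gt3.
split.
- by rewrite a0 expr0n.
- by apply: (mulfI six); rewrite b0; ring.
- by rewrite a1 a0; ring.
by rewrite b1 b0 a0 -[RHS]mulr1 -[X in _ = _ * X]w; ring.
Qed.
End Symmetry.

(** * Alternating sums of squared binomials *)

Lemma coef_1aX_exp (R : comNzRingType) (a : R) N k :
  ((1 + a%:P * 'X) ^+ N)`_k = a ^+ k * 'C(N, k)%:R.
Proof.
elim: N k => [|N IHN] k.
  by rewrite expr0 coef1 bin0n; case: k => [|k]; rewrite ?expr0 ?mulr1 // mulr0.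
rewrite exprS mulrDl mul1r -mulrA coefD coefCM coefXM !IHN.
case: k => [|k] /=; first by rewrite !bin0 mulr0 addr0.
by rewrite binS natrD exprS; ring.
Qed.

(** Compare coefficients in (1 - X)^N (1 + X)^N = (1 - X^2)^N. *)
Lemma sum_bin_alternating (R : comNzRingType) N m :
  \sum_(k < m.*2.+1) (-1) ^+ k * ('C(N, k)%:R * 'C(N, m.*2 - k)%:R) =
  (-1) ^+ m * 'C(N, m)%:R :> R.
Proof.
have : ((1 + (-1)%:P * 'X) ^+ N * (1 + 1%:P * 'X) ^+ N)`_(m.*2) =
       ((1 + (-1)%:P * 'X) ^+ N \Po 'X^2)`_(m.*2) :> R.
  rewrite -exprMn rmorphXn /=; congr (nth 0 (polyseq (_ ^+ N)) _).
  by rewrite rmorphD rmorph1 rmorphM /= comp_polyC comp_polyX polyCN; ring.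
rewrite coefM coef_comp_poly_Xn // -muln2 dvdn_mull // mulnK // coef_1aX_exp => <-.
by apply: eq_bigr => k _; rewrite !coef_1aX_exp expr1n mul1r mulrA.
Qed.

Section BinomialPolynomials.
Variables (F : fieldType) (p n : nat).
Hypothesis pF : p \in [pchar F].
Hypothesis pE : p = n.*2.+1.
Local Notation H := (harm F).

(* This is C(X, k) only for k < p: beyond, k! is not invertible. *)
Fixpoint binp k : {poly F} :=
  if k is l.+1 then l.+1%:R^-1 *: (('X - l%:R%:P) * binp l) else 1.

Lemma size_binp k : (size (binp k) <= k.+1)%N.
Proof.
elim: k => [|k IHk] /=; first by rewrite size_poly1.
apply: leq_trans (size_scale_leq _ _) _; apply: leq_trans (size_polyMleq _ _) _.
by rewrite size_XsubC.
Qed.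

Lemma horner_binp N k : (k < p)%N -> (binp k).[N%:R] = 'C(N, k)%:R.
Proof.
elim: k => [|k IHk] kp /=; first by rewrite hornerC bin0.
have k0 : k.+1%:R != 0 :> F by apply: natr_neq0 pF _ _.
apply: (mulfI k0); rewrite hornerZ mulrA divff // mul1r hornerM hornerXsubC.
rewrite IHk 1?ltnW // -natrM mul_bin_left natrM.
have [kN | Nk] := leqP k N; first by rewrite natrB.
by rewrite bin_small ?mulr0.
Qed.

(** The logarithmic derivative of x (x-1) ... (x-k+1) at n is the sum of 1/(n - j) for j < k. *)
Lemma deriv_binp k : (k <= n)%N ->
  (binp k)^`().[n%:R] = 'C(n, k)%:R * (H n - H (n - k)).
Proof.
elim: k => [|k IHk] kn /=; first by rewrite derivC hornerC subn0 subrr mulr0.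
have [k0 y0 e1 e2 e3] := harm_step pF pE kn.
rewrite derivZ derivM derivB derivX derivC subr0 mul1r hornerZ hornerD hornerM.
rewrite hornerXsubC IHk 1?ltnW // horner_binp; last by rewrite pE; lia.
rewrite e1 e3 (n_double pF pE); move: k0 y0; rewrite -[k.+1%:R]natr1.
move: (H n) (H (n - k)) ('C(n, k)%:R : F) (k%:R : F) (2^-1 : F) => a b d x h k0 y0.
by field; apply/andP.
Qed.

(** Both sides have degree at most n < p and agree at the p residues by [sum_bin_alternating]. The
    polynomial form is needed because it can be differentiated in x. *)
Lemma binp_identity m : n = m.*2 ->
  \sum_(k < n.+1) (-1) ^+ k *: (binp k * binp (n - k)) = (-1) ^+ m *: binp m.
Proof.
move=> nE; apply/eqP; rewrite -subr_eq0; apply/eqP.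
set D := _ - _.
apply: (@roots_geq_poly_eq0 _ _ [seq k%:R | k <- iota 0 p]).
- apply/allP => _ /mapP[N _ ->]; rewrite /root /D hornerD hornerN horner_sum.
  rewrite hornerZ horner_binp; last by rewrite pE; lia.
  rewrite -sum_bin_alternating -nE subr_eq0; apply/eqP/eq_bigr => k _.
  by rewrite hornerZ hornerM !horner_binp // pE; have := ltn_ord k; lia.
- rewrite map_inj_in_uniq ?iota_uniq // => i j; rewrite !mem_iota /= !add0n.
  exact: (natr_inj pF pE).
rewrite size_map size_iota; apply: (@leq_trans n.+1); last by rewrite pE; lia.
rewrite /D; apply: leq_trans (size_polyD _ _) _; rewrite geq_max size_polyN.
apply/andP; split.
  apply: leq_trans (size_sum _ _ _) _; apply/bigmax_leqP => k _.
  apply: leq_trans (size_scale_leq _ _) _; apply: leq_trans (size_polyMleq _ _) _.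
  rewrite -subn1 leq_subLR (leq_trans (leq_add (size_binp _) (size_binp _))) //.
  by have := ltn_ord k; lia.
apply: leq_trans (size_scale_leq _ _) _; apply: leq_trans (size_binp _) _; lia.
Qed.

Lemma sum_alt m : n = m.*2 ->
  \sum_(k < n.+1) alt F n k = (-1) ^+ m * 'C(n, m)%:R.
Proof.
move=> nE; rewrite -sum_bin_alternating -nE; apply: eq_bigr => k _.
by rewrite /alt bin_sub // -ltnS.
Qed.

(** Differentiating [binp_identity] at x = n weights the k-th term with 2 H n - H k - H (n - k); for
    even n reversal makes the last two sums equal. *)
Lemma sum_alt_harm m : n = m.*2 ->
  2 * \sum_(k < n.+1) alt F n k * H k = (-1) ^+ m * 'C(n, m)%:R * (H n + H m).
Proof.
move=> nE; have := congr1 (fun q : {poly F} => q^`().[n%:R]) (binp_identity nE).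
rewrite derivZ hornerZ deriv_binp; last by rewrite nE; lia.
have -> : (n - m = m)%N by rewrite nE; lia.
rewrite mulrA -(sum_alt nE) (raddf_sum (@deriv F)) horner_sum /=.
have term (k : 'I_n.+1) :
    ((-1) ^+ k *: (binp k * binp (n - k)))^`().[n%:R] =
    2 * H n * alt F n k - (alt F n k * H k + alt F n k * H (n - k)).
  have kn : (k <= n)%N by rewrite -ltnS.
  rewrite derivZ derivM hornerZ hornerD !hornerM !deriv_binp ?leq_subr //.
  rewrite !horner_binp ?subKn ?bin_sub //; first by rewrite /alt; ring.
    by rewrite pE; lia.
  by rewrite pE; lia.
rewrite (eq_bigr _ (fun k _ => term k)) sumrB big_split /= -big_distrr /=.
have -> : \sum_(k < n.+1) alt F n k * H (n - k) = \sum_(k < n.+1) alt F n k * H k.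
  have := sum_rev n (fun k => alt F n k * H k); cbv beta => ->.
  have e1 : (-1) ^+ n = 1 :> F by rewrite -signr_odd nE odd_double.
  by apply: eq_bigr => k _; rewrite alt_rev -1?ltnS // e1 mul1r.
have eE : forall a b x y : F, 2 * x * a - (b + b) = a * (x - y) -> 2 * b = a * (x + y).
  move=> a b x y e; transitivity (2 * x * a - (2 * x * a - (b + b))); first by ring.
  by rewrite e; ring.
exact: eE.
Qed.
End BinomialPolynomials.

(** * Fermat quotient and harmonic numbers *)

(** The expansion of (1 + z)^N with z^j replaced by [c j]; with [re_i] it gives the real part of (1
    + i)^N without leaving the integers. *)
Definition binsum (c : nat -> int) N : int := \sum_(j < N.+1) 'C(N, j)%:Z * c j.

Lemma binsumS c N : binsum c N.+1 = binsum c N + binsum (c \o succn) N.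
Proof.
rewrite /binsum big_ord_recl bin0.
under eq_bigr => j _ do rewrite lift0 binS PoszD mulrDl.
rewrite big_split /= addrA; congr (_ + _).
transitivity (\sum_(j < N.+2) 'C(N, j)%:Z * c j).
  by rewrite [in RHS]big_ord_recl bin0.
by rewrite big_ord_recr /= bin_small // mul0r addr0.
Qed.

Lemma binsum_const N : binsum (fun=> 1) N = (2 ^ N)%N.
Proof.
elim: N => [|N IHN]; first by rewrite /binsum big_ord1.
by rewrite binsumS IHN expnS mul2n -addnn PoszD.
Qed.

(* The real part of i^j. *)
Definition re_i j : int := if odd j then 0 else (-1) ^+ j./2.

Lemma re_iSS j : re_i j.+2 = - re_i j.
Proof. by rewrite /re_i /= negbK; case: odd; rewrite ?oppr0 // exprS mulN1r. Qed.

Lemma binsum_ext c d N : c =1 d -> binsum c N = binsum d N.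
Proof. by move=> e; apply: eq_bigr => j _; rewrite e. Qed.

Lemma binsumN c N : binsum (fun j => - c j) N = - binsum c N.
Proof. by rewrite /binsum -sumrN; apply: eq_bigr => j _; rewrite mulrN. Qed.

(** Since (1 + i)^4 = -4, the real part of (1 + i)^(4m+1) is (-4)^m. The shifted sequence
    [re_i \o succn] stands for minus the imaginary part. *)
Lemma binsum_re_i m : binsum re_i (4 * m).+1 = (-4) ^+ m.
Proof.
have st N : binsum re_i N.+4 = -4 * binsum re_i N.
  have sS M : binsum (re_i \o succn) M.+1 = binsum (re_i \o succn) M - binsum re_i M.
    rewrite binsumS -binsumN; congr (_ + _).
    by apply: binsum_ext => j; rewrite /= re_iSS.
  by rewrite !(binsumS re_i, sS); ring.
elim: m => [|m IHm].
  by rewrite muln0 /binsum big_ord_recr big_ord1.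
by rewrite mulnS -addnS addnC addn4 st IHm exprS.
Qed.

Lemma binsum_prime c p : prime p ->
  binsum c p =
  c 0%N + c p + p%:Z * \sum_(1 <= j < p) ('C(p, j) %/ p)%:Z * c j.
Proof.
move=> pp; have p0 := prime_gt0 pp.
rewrite /binsum -(big_mkord xpredT (fun j => 'C(p, j)%:Z * c j)).
rewrite big_nat_recr //= binn mul1r big_ltn // bin0 mul1r addrAC.
congr (_ + _); rewrite big_distrr big_nat_cond [RHS]big_nat_cond /=.
apply: eq_bigr => j /andP[jp _]; rewrite mulrA -PoszM mulnC divnK //.
exact: prime_dvd_bin.
Qed.

Section FermatQuotient.
Variables (F : fieldType) (p n : nat).
Hypothesis pF : p \in [pchar F].
Hypothesis pE : p = n.*2.+1.
Local Notation H := (harm F).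
Let pp : prime p := pcharf_prime pF.

Lemma bin_pred_prime k : (k < p)%N -> 'C(p.-1, k)%:R = (-1) ^+ k :> F.
Proof.
elim: k => [|k IHk] kp; first by rewrite bin0.
have : 'C(p.-1.+1, k.+1)%:R = 0 :> F.
  by apply/eqP; rewrite prednK ?prime_gt0 // -(dvdn_pcharf pF) prime_dvd_bin.
rewrite binS natrD IHk 1?ltnW // exprS mulN1r => /eqP.
by rewrite addr_eq0 => /eqP.
Qed.

Lemma bin_div_prime j : (0 < j < p)%N ->
  ('C(p, j) %/ p)%:R = - (-1) ^+ j / j%:R :> F.
Proof.
move=> jp; have j0 := natr_neq0 pF jp; case: j jp j0 => // j jp j0.
apply: (mulfI j0); rewrite mulrCA divff // mulr1 exprS mulN1r opprK -natrM.
rewrite -bin_pred_prime 1?ltnW //; congr (_%:R).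
apply/eqP; rewrite -(eqn_pmul2r (prime_gt0 pp)) -mulnA divnK ?prime_dvd_bin //.
by rewrite -mul_bin_diag mulnC.
Qed.

(** Both sides are the sum of 2/(2j + 1) for j < k: on the left as 1/(j + 1/2), on the right as
    twice the odd-indexed part of H_{2k}. *)
Lemma harm_reflect k : (k <= n)%N -> H (n - k) - H n = 2 * H k.*2 - H k.
Proof.
elim: k => [|k IHk] kn; first by rewrite subn0 !harm0; ring.
have [k0 y0 _ e2 e3] := harm_step pF pE kn.
have two := two_neq0 pF pE.
have d : k.*2.+1%:R = 2 * (k%:R + 2^-1) :> F.
  by rewrite -natr1 -mul2n natrM; field.
have d2 : k.*2.+2%:R = 2 * (k%:R + 1) :> F.
  by rewrite -natr1 d; field.
rewrite doubleS !harmS d d2 e3 -[k.+1%:R]natr1.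
transitivity (H (n - k) - H n + (k%:R + 2^-1)^-1); first by ring.
rewrite IHk 1?ltnW //; move: k0 y0.
move: (H k.*2) (H k) (k%:R + 1) (k%:R + 2^-1) => a b x y x0 y0.
by field; rewrite two x0.
Qed.

Lemma hdiffE k : (k <= n)%N -> hdiff F n k = H k.*2 - H k.
Proof.
move=> kn; rewrite /hdiff harm_reflect //; field; exact: two_neq0 pF pE.
Qed.

Lemma harm_pred_prime : H n.*2 = 0.
Proof.
have := harm_reflect (leqnn n); rewrite subnn harm0 sub0r => e.
apply: (mulfI (two_neq0 pF pE)); apply: (addIr (- H n)).
by rewrite -e mulr0 add0r.
Qed.

Lemma harm_alternating m :
  \sum_(1 <= j < m.*2.+1) (-1) ^+ j / j%:R = H m - H m.*2 :> F.
Proof.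
elim: m => [|m IHm]; first by rewrite big_geq // subrr.
rewrite doubleS big_nat_recr // big_nat_recr //= IHm !harmS !exprS.
have -> : (-1) ^+ m.*2 = 1 :> F by rewrite -signr_odd odd_double.
have -> : m.*2.+2%:R = 2 * m.+1%:R :> F by rewrite -natrM mul2n.
have two := two_neq0 pF pE; rewrite invfM.
move: (m.*2.+1%:R^-1) (m.+1%:R^-1) => a b.
have {2}-> : b = 2 * (2^-1 * b) by rewrite mulrA divff // mul1r.
ring.
Qed.

Lemma bin_div_prime_sum (c : nat -> int) :
  (\sum_(1 <= j < p) ('C(p, j) %/ p)%:Z * c j)%:~R =
  - \sum_(1 <= j < p) (-1) ^+ j / j%:R * (c j)%:~R :> F.
Proof.
rewrite rmorph_sum -sumrN; apply: eq_big_nat => j jp.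
by rewrite rmorphM /= -pmulrn bin_div_prime // !mulNr.
Qed.

Lemma sum_re_i m :
  \sum_(1 <= j < m.*2.+1) (-1) ^+ j / j%:R * (re_i j)%:~R =
  2^-1 * \sum_(1 <= l < m.+1) (-1) ^+ l / l%:R :> F.
Proof.
elim: m => [|m IHm]; first by rewrite !big_geq // mulr0.
rewrite doubleS big_nat_recr // big_nat_recr //= IHm [in RHS]big_nat_recr //= mulrDr -addrA.
congr (_ + _); rewrite /re_i /= odd_double /= mulr0 add0r doubleK.
have -> : m.*2.+2%:R = 2 * m.+1%:R :> F by rewrite -natrM mul2n.
have -> : (-1) ^+ m.*2.+2 = 1 :> F by rewrite -signr_odd /= negbK odd_double.
by rewrite rmorphXn /= rmorphN1 invfM mul1r; ring.
Qed.

Variable q : nat.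
Hypothesis qE : (2 ^ (p - 1) = 1 + p * q)%N.

Let p_neq0 : p%:Z != 0.
Proof. by have := prime_gt0 pp; lia. Qed.

(** Expanding 2^p = (1 + 1)^p and dividing by p gives 2q = H_{2n} - H_n modulo p, and H_{p-1} =
    0. *)
Lemma harm_half : H n = - (2 * q%:R).
Proof.
have p0 := prime_gt0 pp.
have e : 2 * q%:Z = \sum_(1 <= j < p) ('C(p, j) %/ p)%:Z * 1.
  have h := binsum_prime (fun=> 1) pp; rewrite binsum_const in h.
  apply: (mulfI p_neq0); apply: (addrI (1 + 1)); rewrite -h.
  have -> : (2 ^ p = 2 * (1 + p * q))%N by rewrite -qE -expnS; congr expn; lia.
  by rewrite PoszM PoszD PoszM; ring.
have := congr1 (fun z : int => z%:~R : F) e.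
rewrite bin_div_prime_sum rmorphM /= -!pmulrn => ->.
rewrite opprK pE; transitivity (H n - H n.*2); first by rewrite harm_pred_prime subr0.
rewrite -harm_alternating.
by apply: eq_bigr => j _; rewrite mulr1.
Qed.

(** The real part of (1 + i)^p is (-4)^m = 1 + p T. Its square is 2^(p-1) = 1 + p q, so 2T = q
    modulo p; on the other hand 2T = H n - H m. *)
Lemma harm_quarter m : n = m.*2 -> H m = - (3 * q%:R).
Proof.
move=> nE; have p4 : p = (4 * m).+1 by rewrite pE nE; lia.
have := binsum_prime re_i pp; rewrite {1}p4 binsum_re_i.
have -> : re_i p = 0 by rewrite /re_i pE /= odd_double.
rewrite [re_i 0]expr0 addr0; set T := \sum_(_ <= j < _) _ => e.
have e2 : 2 * T + p%:Z * T ^+ 2 = q%:Z.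
  apply: (mulfI p_neq0); apply: (addrI 1); transitivity (1 + p * q)%N%:Z; last first.
    by rewrite PoszD PoszM.
  rewrite -qE p4 subn1 /= expnM.
  have -> : ((2 ^ 4) ^ m)%N%:Z = (-4) ^+ m * (-4) ^+ m.
    by rewrite -exprMn -rmorphXn.
  by rewrite -p4 e; ring.
have := congr1 (fun z : int => z%:~R : F) e2.
rewrite rmorphD !rmorphM /= -!pmulrn (pcharf0 pF) mul0r addr0 bin_div_prime_sum.
rewrite pE sum_re_i {1}nE harm_alternating -nE harm_half.
have two := two_neq0 pF pE.
rewrite mulrN mulrA divff // mul1r => /eqP; rewrite eqr_oppLR => /eqP h.
have -> : H m = H m - - (2 * q%:R) - 2 * q%:R by ring.
by rewrite h; ring.
Qed.

End FermatQuotient.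

(** * Jacobsthal sums *)

(** As a^2 y^2 - b^2 x^2 = p (a^2 - x^2), one may write a y - b x = z p up to the sign of b. If z =
    0 then a^2 = x^2. Otherwise Brahmagupta's identity gives (a x + b y)^2 = p^2 (1 - z^2) <= 0, so
    a x + b y = 0, whence p = a^2 + x^2. *)
Lemma sum_two_squares_uniq (p a b x y : int) :
  0 < p -> (forall u v, p %| u * v -> p %| u \/ p %| v)%Z ->
  p = a ^+ 2 + b ^+ 2 -> p = x ^+ 2 + y ^+ 2 -> a ^+ 2 = x ^+ 2 \/ a ^+ 2 = y ^+ 2.
Proof.
move=> p0 euclid pab pxy.
suff key b' : p = a ^+ 2 + b' ^+ 2 -> (p %| a * y - b' * x)%Z ->
    a ^+ 2 = x ^+ 2 \/ a ^+ 2 = y ^+ 2.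
  have d : (p %| (a * y - b * x) * (a * y - - b * x))%Z.
    apply/dvdzP; exists (a ^+ 2 - x ^+ 2).
    transitivity (a ^+ 2 * (x ^+ 2 + y ^+ 2) - (a ^+ 2 + b ^+ 2) * x ^+ 2).
      by ring.
    by rewrite -pab -pxy; ring.
  by case: (euclid _ _ d); apply: key; rewrite ?sqrrN.
move=> e /dvdzP[z zE]; have p_neq0 : p != 0 by rewrite gt_eqF.
have [z0 | z0] := eqVneq z 0.
  left; apply/eqP; rewrite -subr_eq0 -(mulrI_eq0 _ (mulfI p_neq0)); apply/eqP.
  transitivity (a ^+ 2 * (x ^+ 2 + y ^+ 2) - (a ^+ 2 + b' ^+ 2) * x ^+ 2).
    by rewrite -e -pxy; ring.
  transitivity ((a * y - b' * x) * (a * y + b' * x)); first by ring.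
  by rewrite zE z0 mul0r mul0r.
right; have id : (a * x + b' * y) ^+ 2 = p ^+ 2 * (1 - z ^+ 2).
  transitivity ((a ^+ 2 + b' ^+ 2) * (x ^+ 2 + y ^+ 2) - (a * y - b' * x) ^+ 2).
    by ring.
  by rewrite -e -pxy zE; ring.
have id0 : a * x + b' * y = 0.
  apply/eqP; rewrite -sqrf_eq0 eq_le sqr_ge0 andbT id.
  rewrite pmulr_rle0 ?exprn_gt0 // subr_le0.
  by rewrite -gtz0_ge1 lt_neqAle eq_sym sqrf_eq0 z0 sqr_ge0.
suff pax : p = a ^+ 2 + x ^+ 2.
  by apply: (addrI (x ^+ 2)); rewrite -pxy pax addrC.
apply: (mulfI p_neq0); apply/eqP; rewrite -subr_eq0; apply/eqP.
transitivity ((p - a ^+ 2) * (p - x ^+ 2) - (a * x) ^+ 2); first by ring.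
rewrite {1}e pxy [_ - a ^+ 2]addrC addKr [_ - x ^+ 2]addrC addKr.
transitivity ((b' * y - a * x) * (a * x + b' * y)); first by ring.
by rewrite id0 mulr0.
Qed.

Section QuadraticCharacter.
Variables (F : finFieldType) (p n : nat).
Hypothesis pF : p \in [pchar F].
Hypothesis pE : p = n.*2.+1.
Hypothesis cardF : #|F| = p.

Lemma natr_ord_bij : bijective (fun i : 'I_p => i%:R : F).
Proof.
apply: inj_card_bij; last by rewrite card_ord cardF.
by move=> i j e; apply/val_inj/(natr_inj pF pE (ltn_ord i) (ltn_ord j) e).
Qed.

Lemma sum_natr (V : nmodType) (f : F -> V) : \sum_t f t = \sum_(i < p) f i%:R.
Proof. by rewrite (reindex _ (onW_bij _ natr_ord_bij)). Qed.

Lemma fermat_little (a : F) : a != 0 -> a ^+ n.*2 = 1.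
Proof.
by move=> a0; apply: (mulfI a0); rewrite -exprS -pE -cardF expf_card mulr1.
Qed.

Lemma nonroot_exists (q : {poly F}) :
  q != 0 -> (size q < p)%N -> exists2 a, a != 0 & ~~ root q a.
Proof.
move=> q0 sq; apply/exists_inP; apply: contraLR sq => none; rewrite -leqNgt.
have := @max_poly_roots _ q [seq i%:R | i <- iota 1 p.-1] q0.
rewrite size_map size_iota => h.
rewrite -(prednK (prime_gt0 (pcharf_prime pF))); apply: h.
  apply/allP => x /mapP[i]; rewrite mem_iota => ii ->.
  have := exists_inPn none i%:R.
  by rewrite negbK; apply; apply: (natr_neq0 pF); lia.
rewrite map_inj_in_uniq ?iota_uniq // => i j; rewrite !mem_iota => ii jj.
by apply: (natr_inj pF pE); lia.
Qed.

Definition chi (a : F) : int :=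
  if a == 0 then 0 else if [exists x, x ^+ 2 == a] then 1 else -1.

Lemma sqr_natr_inj i j : (i <= n)%N -> (j <= n)%N ->
  (i%:R : F) ^+ 2 = j%:R ^+ 2 -> i = j.
Proof.
move=> iN jN /eqP; rewrite eqf_sqr => /orP[/eqP|].
  by apply: (natr_inj pF pE); rewrite pE; lia.
rewrite -addr_eq0 -natrD => e.
case: (posnP (i + j)) => [/eqP|ij0]; first by rewrite addn_eq0 => /andP[/eqP-> /eqP->].
by move: e; rewrite (negPf (natr_neq0 pF _)) // ij0 pE; lia.
Qed.

Lemma euler (a : F) : (chi a)%:~R = a ^+ n.
Proof.
have n0 := n_gt0 pF pE.
rewrite /chi; case: eqVneq => [->|a0]; first by rewrite expr0n eqn0Ngt n0.
case: existsP => [[x /eqP xa]|nr].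
  by rewrite -xa -exprM mul2n fermat_little // -sqrf_eq0 xa.
have /eqP : (a ^+ n) ^+ 2 = 1 by rewrite -exprM muln2 fermat_little.
rewrite sqrf_eq1 => /orP[/eqP an1|/eqP -> //].
(* If a^n were 1, X^n - 1 would have n + 1 distinct roots: [a] and the squares of 1, ..., n. *)
pose s := a :: [seq (i%:R : F) ^+ 2 | i <- iota 1 n].
have q0 : 'X^n - 1 != 0 :> {poly F} by rewrite -size_poly_gt0 size_XnsubC.
have rs : all (root ('X^n - 1)) s.
  rewrite /= rootE !hornerE an1 subrr eqxx /=; apply/allP => x /mapP[i].
  rewrite mem_iota => ii ->; rewrite rootE !hornerE -exprM mul2n fermat_little ?subrr //.
  by apply: (natr_neq0 pF); rewrite pE; lia.
have us : uniq s.
  rewrite /= map_inj_in_uniq ?iota_uniq ?andbT.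
    by apply/mapP => -[i _ ai]; apply: nr; exists i%:R; rewrite ai.
  by move=> i j; rewrite !mem_iota => ii jj; apply: sqr_natr_inj; lia.
have := max_poly_roots q0 rs us.
by rewrite size_XnsubC // /s /= size_map size_iota ltnn.
Qed.

Lemma chi_cases a :
  [\/ a = 0 /\ chi a = 0, a != 0 /\ chi a = 1 | a != 0 /\ chi a = -1].
Proof.
rewrite /chi; case: eqVneq => a0; first by constructor 1.
by case: existsP => _; [constructor 2 | constructor 3].
Qed.

Lemma sign_inj (u v : int) : u \in [:: 0; 1; -1] -> v \in [:: 0; 1; -1] ->
  u%:~R = v%:~R :> F -> u = v.
Proof.
have two := two_neq0 pF pE; have one := oner_neq0 F.
rewrite !inE => /or3P[] /eqP-> /or3P[] /eqP-> //= /eqP; rewrite ?rmorphN1 -subr_eq0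
  -?[1%:~R]/1 -?[0%:~R]/0 ?sub0r ?subr0 ?opprK ?oppr_eq0 ?(negPf one) //.
  by rewrite -[1 + 1]/2 (negPf two).
by rewrite -opprD oppr_eq0 -[1 + 1]/2 (negPf two).
Qed.

Lemma chi_in a : chi a \in [:: 0; 1; -1].
Proof. by rewrite !inE; case: (chi_cases a) => -[_ ->]. Qed.

Lemma chiM a b : chi (a * b) = chi a * chi b.
Proof.
apply: sign_inj; first exact: chi_in.
  by case: (chi_cases a) => -[_ ->]; case: (chi_cases b) => -[_ ->].
by rewrite rmorphM /= !euler exprMn.
Qed.

Lemma chi0 : chi 0 = 0. Proof. by rewrite /chi eqxx. Qed.

Lemma chi_sqr a : a != 0 -> chi a * chi a = 1.
Proof. by move=> a0; case: (chi_cases a) => -[] => [e|_ ->|_ ->] //; rewrite e eqxx in a0. Qed.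

Lemma chi_eq0 a : (chi a == 0) = (a == 0).
Proof. by case: (chi_cases a) => -[e ->]; rewrite ?e ?eqxx ?(negPf e). Qed.

Lemma chi1 : chi 1 = 1.
Proof.
have := chi_sqr (oner_neq0 F); rewrite -chiM mulr1 => e.
by apply: (@sign_inj _ 1); rewrite ?chi_in // euler expr1n.
Qed.

Lemma chi_is_sqr a : chi a = 1 -> exists2 x, x != 0 & a = x ^+ 2.
Proof.
move=> ca; have a0 : a != 0 by rewrite -chi_eq0 ca.
move: ca; rewrite /chi (negPf a0); case: existsP => // -[x /eqP xa] _.
by exists x => //; rewrite -sqrf_eq0 xa.
Qed.

Lemma nonresidue_exists : exists2 g, g != 0 & chi g = -1.
Proof.
have n0 := n_gt0 pF pE.
have [||g g0 ng] := @nonroot_exists ('X^n - 1).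
- by rewrite -size_poly_gt0 size_XnsubC.
- by rewrite size_XnsubC // pE; lia.
exists g => //; have [[e _]|[_ c1]|[_ //]] := chi_cases g.
  by rewrite e eqxx in g0.
by move: ng; rewrite rootE !hornerE -euler c1 subrr eqxx.
Qed.

Lemma sum_chi : \sum_a chi a = 0.
Proof.
have [g g0 cg] := nonresidue_exists.
have : \sum_a chi a = - \sum_a chi a.
  rewrite {1}(reindex_inj (mulfI g0)) -mulN1r big_distrr /=.
  by apply: eq_bigr => a _; rewrite chiM cg.
by lia.
Qed.

(** For u != v, shifting and replacing a by 1/a turns the product into chi(1 + (v - u) a), whose
    full sum is 0; the missing a = 0 accounts for the -1. *)
Lemma sum_chi_pair u v :
  \sum_a chi (a + u) * chi (a + v) = p%:Z * (u == v)%:R - 1.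
Proof.
rewrite (reindex_inj (addIr (- u))) /=.
have [-> | uv] := eqVneq u v.
  rewrite (bigD1 0) //= add0r addNr chi0 mul0r add0r mulr1.
  rewrite (eq_bigr (fun=> 1)) => [|a a0]; last by rewrite addrNK chi_sqr.
  rewrite sumr_const cardC1 cardF natz.
  by have := prime_gt0 (pcharf_prime pF); lia.
rewrite mulr0 sub0r; have w0 : v - u != 0 by rewrite subr_eq0 eq_sym.
rewrite (bigD1 0) //= add0r addNr chi0 mul0r add0r.
transitivity (\sum_(a | a != 0) chi (1 + (v - u) * a)).
  rewrite (reindex_inj invr_inj) /=; apply: eq_big => [a|a a0].
    by rewrite invr_eq0.
  have a0' : a != 0 by rewrite -invr_eq0.
  rewrite addrNK -chiM.
  have -> : a^-1 * (a^-1 - u + v) = a^-1 * a^-1 * (1 + (v - u) * a) by field.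
  by rewrite chiM chiM chi_sqr ?mul1r.
have : \sum_a chi (1 + (v - u) * a) = 0.
  by rewrite -[RHS]sum_chi [RHS](reindex_inj (addrI 1)) [RHS](reindex_inj (mulfI w0)).
by rewrite (bigD1 0) //= mulr0 addr0 chi1 => e; apply: (addrI 1); rewrite e subrr.
Qed.

Definition jacobsthal a : int := \sum_t chi (t * (t ^+ 2 + a)).

Lemma jacobsthal0 : jacobsthal 0 = 0.
Proof.
rewrite -[RHS]sum_chi; apply: eq_bigr => t _; rewrite addr0 -exprS exprSr expr2 !chiM.
by case: (chi_cases t) => -[_ ->].
Qed.

Lemma jacobsthal_scale a k : k != 0 -> jacobsthal (a * k ^+ 2) = chi k * jacobsthal a.
Proof.
move=> k0; rewrite /jacobsthal (reindex_inj (mulfI k0)) big_distrr /=.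
apply: eq_bigr => t _; have -> : k * t * ((k * t) ^+ 2 + a * k ^+ 2) =
  k * k * k * (t * (t ^+ 2 + a)) by ring.
by rewrite !chiM chi_sqr // mul1r.
Qed.
End QuadraticCharacter.

Section Jacobsthal.
Variables (F : finFieldType) (p n m : nat).
Hypothesis pF : p \in [pchar F].
Hypothesis pE : p = n.*2.+1.
Hypothesis cardF : #|F| = p.
Hypothesis nE : n = m.*2.

Let chiM' := chiM pF pE cardF.

Lemma chiN1 : chi (-1 : F) = 1.
Proof.
apply: (sign_inj pF pE) => //; first exact: chi_in.
by rewrite (euler pF pE cardF) nE -signr_odd odd_double.
Qed.

Lemma chiN (a : F) : chi (- a) = chi a.
Proof. by rewrite -mulN1r chiM' chiN1 mul1r. Qed.

Lemma eqN_F (a : F) : (a == - a) = (a == 0).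
Proof.
by rewrite -addr_eq0 -mulr2n -mulr_natl mulf_eq0 (negPf (two_neq0 pF pE)).
Qed.

(** Expand the square and sum over a first: by [sum_chi_pair] only t = s and t = -s receive a factor
    p, and chi(-1) = 1 makes their contributions equal. *)
Lemma sum_jacobsthal_sqr :
  \sum_(a : F) jacobsthal a ^+ 2 = 2 * p%:Z * (p%:Z - 1).
Proof.
transitivity (\sum_(s : F) \sum_(t : F) chi (s * t) * (p%:Z * (s ^+ 2 == t ^+ 2)%:R - 1)).
  under eq_bigr => a _ do rewrite expr2 /jacobsthal big_distrlr /=.
  rewrite exchange_big; apply: eq_bigr => s _ /=.
  rewrite exchange_big; apply: eq_bigr => t _ /=.
  rewrite -(sum_chi_pair pF pE cardF) big_distrr; apply: eq_bigr => a _ /=.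
  by rewrite !chiM' ![_ ^+ 2 + _]addrC; ring.
have row (s : F) : \sum_(t : F) chi (s * t) * (p%:Z * (s ^+ 2 == t ^+ 2)%:R - 1) =
    2 * p%:Z * (s != 0)%:R.
  have -> : \sum_(t : F) chi (s * t) * (p%:Z * (s ^+ 2 == t ^+ 2)%:R - 1) =
      p%:Z * \sum_(t | s ^+ 2 == t ^+ 2) chi (s * t) - chi s * \sum_(t : F) chi t.
    rewrite !big_distrr [in RHS]big_mkcond -sumrB; apply: eq_bigr => t _ /=.
    by rewrite chiM'; case: eqP => _ /=; ring.
  rewrite (sum_chi pF pE cardF) mulr0 subr0.
  have [-> | s0] := eqVneq s 0.
    by rewrite big1 ?mulr0 // => t _; rewrite mul0r chi0.
  rewrite (bigD1 s) // (bigD1 (- s)) /=; last by rewrite sqrrN eqxx eq_sym eqN_F.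
  rewrite big1 => [|t /andP[/andP[st ts] tn]]; last first.
    move: st; rewrite eqf_sqr eq_sym (negPf ts) /= => /eqP st.
    by rewrite st opprK eqxx in tn.
  rewrite mulrN chiN chiM' chi_sqr //; ring.
rewrite (eq_bigr _ (fun s _ => row s)) -big_distrr /=; congr (_ * _).
rewrite (bigD1 0) //= eqxx add0r (eq_bigr (fun=> 1)) => [|a -> //].
by rewrite sumr_const cardC1 cardF natz; have := prime_gt0 (pcharf_prime pF); lia.
Qed.

(** The square of J(a) depends only on a modulo squares, so the sum over a != 0 is (p-1)/2 times
    J(1)^2 + J(g)^2 for a nonresidue [g]. *)
Lemma jacobsthal_sqr_sum : exists b : int,
  jacobsthal (1 : F) ^+ 2 + b ^+ 2 = 4 * p%:Z.
Proof.
have [g g0 cg] := nonresidue_exists pF pE cardF.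
exists (jacobsthal g).
have scale (a k : F) : k != 0 -> jacobsthal (a * k ^+ 2) ^+ 2 = jacobsthal a ^+ 2.
  move=> k0; rewrite (jacobsthal_scale pF pE cardF) // exprMn.
  by rewrite [chi k ^+ 2](chi_sqr k0) mul1r.
(* (1 + chi a)/2 and (1 - chi a)/2 are the indicators of residues and nonresidues. *)
have val (a : F) : a != 0 -> 2 * jacobsthal a ^+ 2 =
    (1 + chi a) * jacobsthal (1 : F) ^+ 2 + (1 - chi a) * jacobsthal g ^+ 2.
  move=> a0; have [[e _]|[_ c1]|[_ c1]] := chi_cases a.
  - by rewrite e eqxx in a0.
  - have [k k0 ->] := chi_is_sqr c1.
    by rewrite -[k ^+ 2]mul1r scale // chiM' (chi1 pF pE cardF) (chiM' k k) chi_sqr //; ring.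
  have [|k k0 e] := @chi_is_sqr _ (g^-1 * a).
    have := chiM' g (g^-1 * a); rewrite mulrA divff // mul1r c1 cg; lia.
  have -> : a = g * k ^+ 2 by rewrite -e mulrA divff ?mul1r.
  rewrite scale // !chiM' cg chi_sqr //; ring.
have j0 := jacobsthal0 pF pE cardF.
have := sum_jacobsthal_sqr; rewrite (bigD1 0) //= j0 expr0n add0r => e.
have e2 : 2 * (2 * p%:Z * (p%:Z - 1)) =
    (p%:Z - 1) * (jacobsthal (1 : F) ^+ 2 + jacobsthal g ^+ 2).
  rewrite -e big_distrr /= (eq_bigr _ val) big_split /= -!big_distrl /=.
  rewrite !big_split /= sumr_const cardC1 cardF natz sumrN.
  have -> : \sum_(a | a != 0 :> F) chi a = 0.
    by rewrite -[RHS](sum_chi pF pE cardF) [RHS](bigD1 0) //= chi0 add0r.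
  have -> : p.-1%:Z = p%:Z - 1 by have := prime_gt0 (pcharf_prime pF); lia.
  ring.
have p1 : p%:Z - 1 != 0 by have := prime_gt1 (pcharf_prime pF); lia.
by apply: (mulfI p1); rewrite -e2; ring.
Qed.

Lemma sum_expf i : (0 < i < p.-1)%N -> \sum_(t : F) t ^+ i = 0.
Proof.
move=> ii; have [||u u0 nu] := @nonroot_exists F p n pF pE cardF ('X^i - 1).
- by rewrite -size_poly_gt0 size_XnsubC //; lia.
- by rewrite size_XnsubC //; lia.
have : \sum_(t : F) t ^+ i = u ^+ i * \sum_(t : F) t ^+ i.
  rewrite {1}(reindex_inj (mulfI u0)) big_distrr /=.
  by apply: eq_bigr => t _; rewrite exprMn.
move/eqP; rewrite -subr_eq0 -{1}[\sum_(t : F) _]mul1r -mulrBl mulf_eq0.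
by rewrite subr_eq0 eq_sym -subr_eq0; move: nu; rewrite rootE !hornerE => /negPf-> /eqP.
Qed.

Lemma sum_expf_pred : \sum_(t : F) t ^+ n.*2 = -1.
Proof.
have n0 := n_gt0 pF pE.
rewrite (bigD1 0) //= expr0n -{1}[n.*2]prednK ?double_gt0 //= add0r.
rewrite (eq_bigr (fun=> 1)) => [|t t0]; last exact: (fermat_little pE cardF).
rewrite sumr_const cardC1 cardF; apply: (addIr 1); rewrite natr1 prednK ?pcharf0 //.
  by rewrite addNr.
exact: prime_gt0 (pcharf_prime pF).
Qed.

(** By Euler's criterion this is the sum of t^n (t^2 + 1)^n. A power sum vanishes unless its
    exponent is a positive multiple of p - 1, which among the n + 2k happens only for k = m. *)
Lemma jacobsthal_mod : (jacobsthal (1 : F))%:~R = - 'C(n, m)%:R :> F.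
Proof.
have n0 := n_gt0 pF pE.
rewrite rmorph_sum /=.
transitivity (\sum_(t : F) \sum_(k < n.+1) 'C(n, k)%:R * t ^+ (n + k.*2)).
  apply: eq_bigr => t _; rewrite (euler pF pE cardF) exprMn addrC exprDn big_distrr /=.
  by apply: eq_bigr => k _; rewrite expr1n mul1r -mulr_natl -exprM mul2n exprD; ring.
rewrite exchange_big /=.
have mn : (m < n.+1)%N by lia.
rewrite (bigD1 (Ordinal mn)) //= [X in _ + X]big1 => [|k km].
  by rewrite -big_distrr /= -nE addnn sum_expf_pred mulrN1 addr0.
have {}km : (k : nat) != m by apply: contra km => /eqP e; apply/eqP/val_inj.
rewrite -big_distrr /=; have kn := ltn_ord k.
have [lt | ge] := ltnP (n + k.*2) p.-1.
  by rewrite sum_expf ?mulr0 //; lia.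
(* The exponent exceeds p - 1, so it stays positive when lowered by p - 1 and t = 0 still
   contributes 0. *)
have -> : \sum_(t : F) t ^+ (n + k.*2) = \sum_(t : F) t ^+ (n + k.*2 - n.*2).
  apply: eq_bigr => t _; have [-> | t0] := eqVneq t 0.
    by rewrite !expr0n; congr (_%:R); lia.
  by rewrite -{1}(@subnK n.*2 (n + k.*2)) ?exprD ?(fermat_little pE cardF) ?mulr1 //; lia.
by rewrite sum_expf ?mulr0 //; lia.
Qed.

Let f (i : nat) : int := chi (i%:R * (i%:R ^+ 2 + 1) : F).

Lemma jacobsthal_double : jacobsthal (1 : F) = 2 * \sum_(i < n) f i.+1.
Proof.
rewrite /jacobsthal (sum_natr pF pE cardF) pE -addnn big_ord_recl mul0r chi0 add0r.
rewrite big_split_ord /= mulr_natl mulr2n; congr (_ + _).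
rewrite (reindex_inj rev_ord_inj); apply: eq_bigr => i _ /=.
have -> : (bump 0 (n + (n - i.+1)))%:R = - i.+1%:R :> F.
  apply/eqP; rewrite -addr_eq0 -natrD -(dvdn_pcharf pF) /bump /=.
  by have := ltn_ord i; rewrite pE => ?; apply/dvdnP; exists 1%N; lia.
by rewrite sqrrN mulNr chiN.
Qed.

(** Exactly one of 1, ..., n squares to -1 and gives a zero term; the other n - 1 terms are signs,
    and n - 1 is odd. *)
Lemma jacobsthal_odd_half : ~~ (2 %| \sum_(i < n) f i.+1)%Z.
Proof.
have n0 := n_gt0 pF pE.
have [x x0 xE] := chi_is_sqr chiN1.
have [j jn jE] : exists2 j, (0 < j <= n)%N & j%:R ^+ 2 = -1 :> F.
  have [h _ hK] := natr_ord_bij pF pE cardF.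
  move: x0 xE; rewrite -(hK x); move: (h x) => k k0 kE.
  have kp := ltn_ord k; have k1 : (k != 0 :> nat) by apply: contraNneq k0 => ->.
  have [kn | nk] := leqP k n; first by exists k; rewrite ?kE //; lia.
  exists (p - k)%N; first by have := pE; lia.
  by rewrite natrB 1?ltnW // (pcharf0 pF) sub0r sqrrN kE.
have jn' : (j.-1 < n)%N by lia.
pose j' := Ordinal jn'.
rewrite (bigD1 j') //= {1}/f prednK; last by lia.
rewrite jE addNr mulr0 chi0 add0r.
have d : (2 %| \sum_(i < n | i != j') (f i.+1 - 1))%Z.
  apply: rpred_sum => i ij; rewrite /f.
  have [[z _]|[_ ->] //|[_ ->] //] := chi_cases (i.+1%:R * (i.+1%:R ^+ 2 + 1) : F).
  have i0 : i.+1%:R != 0 :> F.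
    by apply: (natr_neq0 pF); have := ltn_ord i; lia.
  move/eqP: z; rewrite mulf_eq0 (negPf i0).
  rewrite /= addr_eq0 -jE => /eqP /(sqr_natr_inj pF pE) e.
  case/eqP: ij; apply/val_inj => /=; rewrite -e //; lia.
move: d; rewrite sumrB sumr_const cardC1 card_ord natz => d.
move: (\sum_(i < n | _) _) d => z d.
by apply/negP => d2; move: d d2; rewrite nE; lia.
Qed.

(** J(1) = 2z with z odd, and halving J(1)^2 + b^2 = 4p gives p = z^2 + b'^2. By uniqueness z^2 is
    x^2 or y^2, the latter being impossible since x and y would both be odd and p even. *)
Theorem gauss_binomial (x y : int) :
  p%:Z = x ^+ 2 + y ^+ 2 -> ~~ (2 %| x)%Z ->
  'C(n, m)%:R ^+ 2 = 4 * x%:~R ^+ 2 :> F.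
Proof.
move=> pxy ox; have [b jb] := jacobsthal_sqr_sum.
have oz := jacobsthal_odd_half; have jz := jacobsthal_double.
have jm := jacobsthal_mod.
move: (\sum_(i < n) f i.+1) oz jz => z oz jz.
suff e : z ^+ 2 = x ^+ 2.
  have -> : 4 * x%:~R ^+ 2 = (2 * z)%:~R ^+ 2 :> F.
    by rewrite rmorphM /= exprMn -!rmorphXn /= e; ring.
  by rewrite -jz jm sqrrN.
have [b' bE] : exists b', b = 2 * b'.
  have d : (2 %| b ^+ 2)%Z.
    apply/dvdzP; exists (2 * (p%:Z - z ^+ 2)).
    apply: (addrI (jacobsthal (1 : F) ^+ 2)); rewrite jb jz; ring.
  have {}d : (2 %| b)%Z by move: d; rewrite !dvdzE abszX Euclid_dvdX // andbT.
  by case/dvdzP: d => c ->; exists c; rewrite mulrC.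
have pz : p%:Z = z ^+ 2 + b' ^+ 2.
  by apply: (@mulfI _ 4) => //; rewrite -jb jz bE; ring.
have pp := pcharf_prime pF.
have eucl u v : (p%:Z %| u * v -> p%:Z %| u \/ p%:Z %| v)%Z.
  by rewrite !dvdzE abszM Euclid_dvdM // => /orP.
have p0 : 0 < p%:Z by have := prime_gt0 pp; lia.
have [//|ey] := sum_two_squares_uniq p0 eucl pz pxy.
have odd_dec (t : int) : ~~ (2 %| t)%Z -> exists t', t = 2 * t' + 1.
  by move=> ot; exists (t %/ 2)%Z; lia.
have oy : ~~ (2 %| y)%Z.
  apply: contra oz; rewrite !dvdzE => dy.
  have : (2 %| `|(y ^+ 2)%R|)%N by rewrite abszX Euclid_dvdX // dy.
  by rewrite -ey abszX Euclid_dvdX // andbT.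
have [x' xE] := odd_dec _ ox; have [y' yE] := odd_dec _ oy.
exfalso; move: pxy; rewrite xE yE pE.
have -> : (2 * x' + 1) ^+ 2 + (2 * y' + 1) ^+ 2 =
  2 * (2 * x' ^+ 2 + 2 * x' + 2 * y' ^+ 2 + 2 * y' + 1) by ring.
move: (2 * x' ^+ 2 + _ + _ + _ + _) => w; lia.
Qed.

End Jacobsthal.

(** * Reduction of p-integral rationals *)

Section Reduction.
Variables (F : fieldType) (p : nat).
Hypothesis pF : p \in [pchar F].

Lemma intr_eq0_dvd (z : int) : (z%:~R == 0 :> F) = (p %| z)%Z.
Proof.
rewrite dvdzE (dvdn_pcharf pF) /=.
by case: z => k //; rewrite NegzE mulrNz oppr_eq0.
Qed.

(** The graph of the reduction map from Z_(p) to [F]. As a relation it accepts fractions not in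
    lowest terms, so the reduced denominator matters only in [reduces_eqmod]. *)
Definition reduces_to (r : rat) (a : F) : Prop :=
  exists u v : int, [/\ v%:~R != 0 :> F, r = u%:~R / v%:~R & a = u%:~R / v%:~R].

Lemma intr_F_neq0 (v : int) : v%:~R != 0 :> F -> v%:~R != 0 :> rat.
Proof. by apply: contraNneq => /eqP; rewrite intr_eq0 => /eqP ->. Qed.

Lemma reduces_int z : reduces_to z%:~R z%:~R.
Proof. by exists z, 1; rewrite oner_neq0 !divr1. Qed.

Lemma reduces_nat k : reduces_to k%:R k%:R.
Proof. by have := reduces_int k; rewrite -!pmulrn. Qed.

Lemma reduces_add r a s b :
  reduces_to r a -> reduces_to s b -> reduces_to (r + s) (a + b).
Proof.
move=> [u [v [v0 -> ->]]] [u' [v' [v0' -> ->]]].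
have [w0 w0'] := (intr_F_neq0 v0, intr_F_neq0 v0').
exists (u * v' + u' * v), (v * v'); rewrite !rmorphM !rmorphD !rmorphM /=.
by rewrite mulf_neq0 //; split=> //; field; apply/andP.
Qed.

Lemma reduces_mul r a s b :
  reduces_to r a -> reduces_to s b -> reduces_to (r * s) (a * b).
Proof.
move=> [u [v [v0 -> ->]]] [u' [v' [v0' -> ->]]].
have [w0 w0'] := (intr_F_neq0 v0, intr_F_neq0 v0').
exists (u * u'), (v * v'); rewrite !rmorphM /=.
by rewrite mulf_neq0 //; split=> //; field; apply/andP.
Qed.

Lemma reduces_opp r a : reduces_to r a -> reduces_to (- r) (- a).
Proof. by move/(reduces_mul (reduces_int (-1))); rewrite !rmorphN1 !mulN1r. Qed.

Lemma reduces_sub r a s b :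
  reduces_to r a -> reduces_to s b -> reduces_to (r - s) (a - b).
Proof. by move=> ra /reduces_opp; apply: reduces_add. Qed.

Lemma reduces_inv r a : a != 0 -> reduces_to r a -> reduces_to r^-1 a^-1.
Proof.
move=> a0 [u [v [v0 -> aE]]]; exists v, u; rewrite aE !invf_div; split=> //.
by apply: contraNneq a0 => u0; rewrite aE u0 mul0r.
Qed.

Lemma reduces_div r a s b :
  b != 0 -> reduces_to r a -> reduces_to s b -> reduces_to (r / s) (a / b).
Proof. by move=> b0 ra /(reduces_inv b0); apply: reduces_mul. Qed.

Lemma reduces_exp r a k : reduces_to r a -> reduces_to (r ^+ k) (a ^+ k).
Proof.
move=> ra; elim: k => [|k IHk]; first exact: (reduces_nat 1).
by rewrite !exprS; apply: reduces_mul.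
Qed.

Lemma reduces_sum (I : eqType) (l : seq I) (r : I -> rat) (a : I -> F) :
  {in l, forall i, reduces_to (r i) (a i)} ->
  reduces_to (\sum_(i <- l) r i) (\sum_(i <- l) a i).
Proof.
elim: l => [|i l IHl] ra; first by rewrite !big_nil; exact: (reduces_nat 0).
rewrite !big_cons; apply: reduces_add; first by apply: ra; rewrite mem_head.
by apply: IHl => j jl; apply: ra; rewrite in_cons jl orbT.
Qed.

Lemma reduces_eqmod r s a : reduces_to r a -> reduces_to s a -> rat_eqmod p r s.
Proof.
move=> ra sa; have [u [v [v0 e0]]] := reduces_sub ra sa.
rewrite subrr => /esym/eqP; rewrite mulf_eq0 invr_eq0 (negPf v0) orbF.
rewrite intr_eq0_dvd => /dvdzP[w uE]; exists (w%:~R / v%:~R); last first.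
  by rewrite e0 uE rmorphM /= -pmulrn mulrAC mulrC.
have pp := pcharf_prime pF; have w0 := intr_F_neq0 v0.
set t := _ / _; rewrite inE coprime_sym prime_coprime //.
have e : numq t * v = w * denq t.
  apply/eqP; rewrite -(eqr_int rat) !rmorphM /= numqE /t.
  by rewrite mulrAC divfK.
(* By Gauss' lemma the reduced denominator of [t] divides [v], which p does not. *)
have : (denq t %| v * numq t)%Z by apply/dvdzP; exists w; rewrite mulrC.
rewrite Gauss_dvdzl; last by rewrite /coprimez gcdzC; exact: coprime_num_den.
move=> dv; apply: contra v0 => pd; rewrite intr_eq0_dvd.
by apply: dvdz_trans dv; rewrite dvdzE.
Qed.

Lemma reduces_harmonic k : (k < p)%N -> reduces_to (harmonic k) (harm F k).
Proof.
move=> kp; apply: reduces_sum => j; rewrite mem_index_iota => jk.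
by apply: reduces_inv (reduces_nat j); apply: (natr_neq0 pF); lia.
Qed.

(** For k < 2p the only denominator divisible by p is p itself, and p/p = 1. *)
Lemma reduces_harmonic_mulp k : (k < p.*2)%N ->
  exists a, reduces_to (p%:R * harmonic k) a.
Proof.
move=> kp; elim: k kp => [|k IHk] kp.
  by exists 0; rewrite /harmonic big_geq // mulr0; exact: (reduces_nat 0).
have [a ra] := IHk (ltnW kp).
rewrite /harmonic big_nat_recr //= mulrDr.
have [b rb] : exists b, reduces_to (p%:R / k.+1%:R) b.
  have [<- | kp'] := eqVneq p k.+1.
    exists 1; rewrite divff; first exact: (reduces_nat 1).
    by rewrite pnatr_eq0 -lt0n (prime_gt0 (pcharf_prime pF)).
  exists (p%:R / k.+1%:R); apply: reduces_div (reduces_nat _) (reduces_nat _).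
  rewrite -(dvdn_pcharf pF); apply: contra kp' => /dvdnP[[|[|c]] kE]; move: kp; lia.
by exists (a + b); apply: reduces_add.
Qed.

End Reduction.

(** * Reduction of the two harmonic sums *)

Section Values.
Variables (F : finFieldType) (p n : nat).
Hypothesis pF : p \in [pchar F].
Hypothesis pE : p = n.*2.+1.
Hypothesis cardF : #|F| = p.
Hypothesis p_gt3 : (3 < p)%N.
Let pp : prime p := pcharf_prime pF.
Let two : 2 != 0 :> F := two_neq0 pF pE.

Local Notation H := (harm F).
Local Notation c k := ('C(n, k)%:R : F).

Lemma central_bin k : (k < p)%N -> 'C(2 * k, k)%:R = (-4) ^+ k * c k.
Proof.
elim: k => [|k IHk] kp; first by rewrite muln0 !bin0 mulr1.
have k0 : k.+1%:R != 0 :> F by apply: (natr_neq0 pF).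
apply: (mulfI k0).
have -> : k.+1%:R * ((-4) ^+ k.+1 * c k.+1) = (-4) ^+ k.+1 * (k.+1%:R * c k.+1) :> F.
  by ring.
rewrite (bin_rec pF pE).
have nat_rec : (k.+1 * 'C(2 * k.+1, k.+1) = 2 * (k.*2.+1 * 'C(2 * k, k)))%N.
  have -> : (2 * k.+1 = k.*2.+2)%N by lia.
  have -> : (2 * k = k.*2)%N by lia.
  have e1 := mul_bin_diag k.*2.+2 k; have e3 := mul_bin_down k.*2.+1 k.
  rewrite /= in e1 e3.
  have s1 : (k.*2.+1 - k = k.+1)%N by lia.
  rewrite s1 in e3; rewrite -e1 -doubleS -mul2n -mulnA; congr (2 * _)%N.
  by rewrite -e3.
rewrite -natrM nat_rec natrM [in LHS]natrM IHk 1?ltnW // exprS.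
have -> : k.*2.+1%:R = 2 * (k%:R + 2^-1) :> F by rewrite -natr1 -mul2n natrM; field.
by ring.
Qed.

Lemma central_bin_dvd k : (n < k < p)%N -> (p %| 'C(2 * k, k))%N.
Proof.
by move=> kp; rewrite (dvdn_pcharf pF) central_bin ?bin_small ?mulr0 //; lia.
Qed.

(* The image in [F] of the harmonic sum with parameter [m], for [x = -64 / m]. *)
Definition twisted (x : F) : F :=
  \sum_(k < n.+1) k%:R * (c k ^+ 3 * x ^+ k * hdiff F n k).

Lemma reduces_harmonic_sum (m : int) : m%:~R != 0 :> F ->
  reduces_to (harmonic_sum p m%:~R) (twisted (-64 / m%:~R)).
Proof.
move=> m0; have mk0 k : m%:~R ^+ k != 0 :> F by rewrite expf_neq0.
rewrite /harmonic_sum (big_cat_nat _ (n := n.+1)) //=; last by rewrite pE; lia.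
rewrite -[twisted _]addr0; apply: reduces_add; last first.
  rewrite -(_ : \sum_(n.+1 <= k < p) 0 = 0 :> F); last by rewrite big1.
  apply: reduces_sum => k; rewrite mem_index_iota => kp.
  have /dvdnP[d dE] := central_bin_dvd kp.
  have [|a ra] := reduces_harmonic_mulp pF (k := 2 * k); first by lia.
  have [|b rb] := reduces_harmonic_mulp pF (k := k); first by lia.
  (* For k > n the harmonic numbers may have p in the denominator. One factor p of a central
     binomial clears it, and another copy of that binomial still makes the term 0. *)
  have -> : (k * 'C(2 * k, k) ^ 3)%:R / m%:~R ^+ k * (harmonic (2 * k) - harmonic k) =
      ('C(2 * k, k) * (k * d * 'C(2 * k, k)))%:R / m%:~R ^+ k *
      (p%:R * harmonic (2 * k) - p%:R * harmonic k).
    rewrite {1}(_ : 'C(2 * k, k) ^ 3 = d * p * ('C(2 * k, k) ^ 2))%N; last first.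
      by rewrite -dE -expnS.
    by rewrite !(natrM, natrX); ring.
  have -> : 0 = ('C(2 * k, k) * (k * d * 'C(2 * k, k)))%:R / m%:~R ^+ k * (a - b) :> F.
    rewrite natrM central_bin; last by lia.
    by rewrite bin_small; [rewrite mulr0 !mul0r | lia].
  apply: reduces_mul; last exact: reduces_sub.
  by apply: reduces_div => //; [exact: reduces_nat|apply: reduces_exp; exact: reduces_int].
rewrite /twisted -(big_mkord xpredT
  (fun k => k%:R * (c k ^+ 3 * (-64 / m%:~R) ^+ k * hdiff F n k))).
apply: reduces_sum => k; rewrite mem_index_iota => kn.
have -> : k%:R * (c k ^+ 3 * (-64 / m%:~R) ^+ k * hdiff F n k) =
   (k * 'C(2 * k, k) ^ 3)%:R / m%:~R ^+ k * (H (2 * k) - H k) :> F.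
  rewrite natrM natrX central_bin; last by rewrite pE; lia.
  rewrite (hdiffE pF pE) // mul2n.
  have -> : -64 = (-4) ^+ 3 :> F by ring.
  have -> : (((-4) ^+ 3) / m%:~R) ^+ k = ((-4) ^+ k) ^+ 3 / m%:~R ^+ k :> F.
    by rewrite expr_div_n -!exprM mulnC.
  by ring.
apply: reduces_mul.
  by apply: reduces_div => //; [exact: reduces_nat|apply: reduces_exp; exact: reduces_int].
by apply: reduces_sub; apply: (reduces_harmonic pF); rewrite pE; lia.
Qed.

Lemma legendre_chi (a : int) : legendre a p = chi (a%:~R : F).
Proof.
rewrite /legendre /chi (intr_eq0_dvd pF); case: ifP => // _.
have modF (x : 'I_p) : (x%:Z ^+ 2 == a %[mod p%:Z])%Z = (x%:R ^+ 2 == a%:~R :> F).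
  by rewrite eqz_mod_dvd -(intr_eq0_dvd pF) rmorphB rmorphXn /= -pmulrn subr_eq0.
have [h _ hK] := natr_ord_bij pF pE cardF.
congr (if _ then _ else _); apply/existsP/existsP => -[x].
  by rewrite modF => xa; exists x%:R.
by rewrite -(hK x) -modF => xa; exists (h x).
Qed.

Let S (w : nat -> F) := \sum_(k < n.+1) w k.
Let A0 := S (cub F n).
Let A1 := S (fun k => k%:R * cub F n k).
Let B0 := S (fun k => cub F n k * hdiff F n k).
Let B1 := S (fun k => k%:R * (cub F n k * hdiff F n k)).

Lemma twisted8 : twisted 8 = B1.
Proof. by apply: eq_bigr => k _; rewrite /cub; ring. Qed.

Lemma four_pow : 4 ^+ n = 1 :> F.
Proof.
have -> : 4 = 2 ^+ 2 :> F by ring.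
by rewrite -exprM mul2n (fermat_little pE cardF).
Qed.

Let eight : 8 != 0 :> F.
Proof. by rewrite -[8]/((2 ^ 3)%:R) natrX expf_neq0. Qed.

Lemma hdiff_rev k : (k <= n)%N -> hdiff F n (n - k) = - H n - hdiff F n k.
Proof. by move=> kn; rewrite /hdiff subKn //; field. Qed.

(** Reversal turns (1/8)^k into 8^k / 8^n, and (-2)^n = (-1)^n 8^n because 4^n = 1. The factor n - k
    = -1/2 - k and [hdiff_rev] produce the four terms. *)
Lemma twisted8V :
  (-2) ^+ n * twisted 8^-1 =
  (-1) ^+ n * (H n * A0 / 2 + H n * A1 + B0 / 2 + B1).
Proof.
have -> : (-2) ^+ n = (-1) ^+ n * 8 ^+ n :> F.
  rewrite -exprMn (_ : -1 * 8 = 4 * -2); last by ring.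
  by rewrite exprMn four_pow mul1r.
rewrite -mulrA; congr (_ * _).
have hn := n_double pF pE.
transitivity (- n%:R * (H n * A0) + H n * A1 - n%:R * B0 + B1); last first.
  by rewrite hn; field.
have := sum_rev n (fun k => k%:R * (c k ^+ 3 * (8^-1) ^+ k * hdiff F n k)).
rewrite -/(twisted _) => ->.
rewrite /A0 /A1 /B0 /B1 /S; move: (H n) (hdiff_rev) => a hr.
rewrite !big_distrr /= -big_split -sumrB -big_split /=; apply: eq_bigr => k _.
have kn : (k <= n)%N by rewrite -ltnS.
rewrite hr // bin_sub // natrB // /cub exprVn -{1}(subnKC kn) exprD.
have e8 : 8 ^+ (n - k) != 0 :> F by rewrite expf_neq0.
by move: e8; move: (8 ^+ (n - k)) => x x0; field.
Qed.

End Values.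

(** * The congruences in the prime field *)

Section Congruences.
Variables (p n : nat).
Hypothesis pp : prime p.
Hypothesis pE : p = n.*2.+1.
Hypothesis p_gt3 : (3 < p)%N.

Local Notation F := ('F_p).
Let pF : p \in [pchar F] := pchar_Fp pp.
Let cardF : #|F| = p := card_Fp pp.

Lemma intr8 : (-8)%:~R != 0 :> F.
Proof.
have two := two_neq0 pF pE.
have -> : (-8)%:~R = - 2 ^+ 3 :> F by ring.
by rewrite oppr_eq0 expf_neq0.
Qed.

Lemma reduces_S8 :
  reduces_to (harmonic_sum p (-8) - (-1) ^+ ((p - 1) %/ 2) / 6)
   (twisted n (8 : F) - (-1) ^+ n / 6).
Proof.
have two := two_neq0 pF pE.
have three : 3 != 0 :> F by apply: (natr_neq0 pF).
have six : 6 != 0 :> F by rewrite -[6]/((2 * 3)%:R) natrM mulf_neq0.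
have -> : ((p - 1) %/ 2 = n)%N by rewrite pE; lia.
apply: reduces_sub.
  have := reduces_harmonic_sum pF pE cardF p_gt3 intr8.
  have -> : -64 / (-8)%:~R = 8 :> F.
    have e8 := intr8; apply: (mulIf e8); rewrite divfK //; ring.
  by [].
apply: reduces_div => //; last exact: reduces_nat.
by apply: reduces_exp; apply: reduces_opp; exact: (reduces_nat _ 1).
Qed.

Lemma reduces_S512 :
  reduces_to ((legendre (-2) p)%:~R * harmonic_sum p (-512) - 1 / 6)
   ((-2) ^+ n * twisted n (8^-1 : F) - 1 / 6).
Proof.
have two := two_neq0 pF pE.
have three : 3 != 0 :> F by apply: (natr_neq0 pF).
have six : 6 != 0 :> F by rewrite -[6]/((2 * 3)%:R) natrM mulf_neq0.
have e512 : (-512)%:~R != 0 :> F.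
  have -> : (-512)%:~R = - 2 ^+ 9 :> F by ring.
  by rewrite oppr_eq0 expf_neq0.
apply: reduces_sub; last first.
  by apply: reduces_div; [exact: six|exact: (reduces_nat _ 1)|exact: reduces_nat].
apply: reduces_mul.
  have -> : (-2) ^+ n = (legendre (-2) p)%:~R :> F.
    rewrite (legendre_chi pF pE cardF) (euler pF pE cardF).
    by congr (_ ^+ _); ring.
  exact: reduces_int.
have := reduces_harmonic_sum pF pE cardF p_gt3 e512.
have -> : -64 / (-512)%:~R = 8^-1 :> F.
  have e8 : 8 != 0 :> F by rewrite -[8]/((2 ^ 3)%:R) natrX expf_neq0.
  apply: (mulIf e512); rewrite divfK //.
  have -> : (-512)%:~R = 8 * -64 :> F by ring.
  by rewrite mulKf.
by [].
Qed.

Local Notation H := (harm F).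
Let S (w : nat -> F) := \sum_(k < n.+1) w k.
Let A0 := S (cub F n).
Let A1 := S (fun k => k%:R * cub F n k).
Let B0 := S (fun k => cub F n k * hdiff F n k).
Let B1 := S (fun k => k%:R * (cub F n k * hdiff F n k)).
Let two : 2 != 0 :> F := two_neq0 pF pE.
Let three : 3 != 0 :> F.
Proof. by apply: (natr_neq0 pF). Qed.
Let six : 6 != 0 :> F.
Proof. by rewrite -[6]/((2 * 3)%:R) natrM mulf_neq0. Qed.
Let eighteen : 18 != 0 :> F.
Proof. by rewrite -[18]/((3 * 6)%:R) natrM mulf_neq0. Qed.

Let values8 : twisted n (8 : F) = B1.
Proof. exact: twisted8. Qed.

Let values8V : (-2) ^+ n * twisted n (8^-1 : F) =
  (-1) ^+ n * (H n * A0 / 2 + H n * A1 + B0 / 2 + B1).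
Proof. exact: (twisted8V pF pE cardF). Qed.

Lemma congruences_odd : odd n ->
  twisted n (8 : F) - (-1) ^+ n / 6 = 0 /\
  (-2) ^+ n * twisted n (8^-1 : F) - 1 / 6 = 0.
Proof.
move=> on; have [a0 b0 a1 b1] : [/\ A0 = 0, B0 = 0, 3 * A1 + A0 = 0
    & 18 * B1 + 6 * B0 + 3 * A0 = -3] := harmonic_relations_odd pF pE p_gt3 on.
rewrite values8 values8V.
have e1 : (-1) ^+ n = -1 :> F by rewrite -signr_odd on.
have {}a1 : A1 = 0.
  by apply: (mulfI three); rewrite mulr0; move: a1; rewrite a0 addr0.
have {}b1 : B1 = - 6^-1.
  apply: (mulfI eighteen); transitivity (18 * B1 + 6 * B0 + 3 * A0).
    by rewrite b0 a0; ring.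
  by rewrite b1; field; exact: six.
rewrite a0 a1 b0 b1 e1; split; field; rewrite ?two ?three ?six //.
Qed.

Lemma congruences_even m q (x y : int) : n = m.*2 ->
  (2 ^ (p - 1) = 1 + p * q)%N -> p%:Z = x ^+ 2 + y ^+ 2 -> ~~ (2 %| x)%Z ->
  twisted n (8 : F) - (-1) ^+ n / 6 = - (2 * (q%:R + 1) * x%:~R ^+ 2 / 3) /\
  (-2) ^+ n * twisted n (8^-1 : F) - 1 / 6 =
    - ((3 * q%:R + 2) * x%:~R ^+ 2 / 3).
Proof.
move=> nE qE pxy ox; have en : ~~ odd n by rewrite nE odd_double.
pose s0 := S (alt F n); pose sh := S (fun k => alt F n k * H k).
have [a0 b0 a1 b1] : [/\ A0 = s0 ^+ 2, 3 * B0 = s0 * (sh - 2 * H n * s0),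
    3 * A1 + A0 = 0 & 18 * B1 + 6 * B0 + 3 * A0 = 3] :=
  harmonic_relations_even pF pE en.
rewrite values8 values8V.
have e1 : (-1) ^+ n = 1 :> F by rewrite -signr_odd (negPf en).
have hn := harm_half pF pE qE; have hm := harm_quarter pF pE qE nE.
have s0E : s0 = (-1) ^+ m * 'C(n, m)%:R := sum_alt F nE.
have shE : 2 * sh = s0 * (H n + H m) by rewrite s0E; exact: (sum_alt_harm pF pE nE).
have A0x : A0 = 4 * x%:~R ^+ 2.
  rewrite a0 s0E exprMn exprAC sqrrN expr1n expr1n mul1r.
  exact: (gauss_binomial pF pE cardF nE pxy ox).
(* 6 B0 = A0 (H m - 3 H n), and H m - 3 H n = -3q + 6q = 3q. *)
have {}b0 : B0 = q%:R * A0 / 2.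
  apply: (mulfI six); transitivity (2 * (3 * B0)); first by ring.
  transitivity (s0 * (2 * sh) - 4 * H n * s0 ^+ 2); first by rewrite b0; ring.
  by rewrite shE -a0 hn hm mulrA -expr2 -a0; field.
have {}a1 : A1 = - A0 / 3.
  by apply: (mulfI three); apply: (addIr A0); rewrite a1; field; exact: three.
have {}b1 : B1 = (1 - (q%:R + 1) * A0) / 6.
  apply: (mulfI eighteen).
  transitivity (18 * B1 + 6 * B0 + 3 * A0 - 6 * B0 - 3 * A0); first by ring.
  by rewrite b1 b0; field; rewrite two six.
rewrite e1 hn a1 b0 b1 A0x; split; field; rewrite ?two ?three ?six //.
Qed.
End Congruences.

Lemma sum_two_squares_mod4 (p n : nat) (x y : int) :
  p = n.*2.+1 -> p%:Z = x ^+ 2 + y ^+ 2 -> ~~ (2 %| x)%Z -> ~~ odd n.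
Proof.
move=> pE pxy ox.
have [x' xE] : exists x', x = 2 * x' + 1 by exists (x %/ 2)%Z; lia.
have [y' [b yE b01]] : exists y', exists2 b, y = 2 * y' + b & b = 0 \/ b = 1.
  by exists (y %/ 2)%Z, (y %% 2)%Z; lia.
have e : p%:Z = 4 * (x' ^+ 2 + x' + y' ^+ 2 + y' * b) + 1 + b ^+ 2.
  by rewrite pxy xE yE; ring.
move: e; rewrite pE; move: (_ + y' * b) => w.
by case: b01 => ->; rewrite ?expr0n ?expr1n /=; lia.
Qed.

Unset Implicit Arguments.
Set Strict Implicit.

Theorem corollary4p4 (p : nat) (p_prime : prime p) (p_gt3 : (3 < p)%N) :
  let q : rat := fermat_quotient p 2 in
  let S8 : rat := harmonic_sum p (-8) - (-1) ^+ ((p - 1) %/ 2) / 6 in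
  let S512 : rat :=
    (legendre (-2) p)%:~R * harmonic_sum p (-512) - 1 / 6 in
  ((forall x y : int, p%:Z = x ^+ 2 + y ^+ 2 -> ~~ (2 %| x)%Z ->
      rat_eqmod p S8 (- (2 * (q + 1) * x%:~R ^+ 2 / 3)))
   /\ (p = 3 %[mod 4] -> rat_eqmod p S8 0))
  /\
  ((forall x y : int, p%:Z = x ^+ 2 + y ^+ 2 -> ~~ (2 %| x)%Z ->
      rat_eqmod p S512 (- ((3 * q + 2) * x%:~R ^+ 2 / 3)))
   /\ (p = 3 %[mod 4] -> rat_eqmod p S512 0)).
Proof.
move=> q S8 S512.
have p0 := prime_gt0 p_prime.
have pF : p \in [pchar 'F_p] := pchar_Fp p_prime.
have [n pE] : exists n, p = n.*2.+1.
  exists p./2; have [e|o] := even_prime p_prime; first by rewrite e in p_gt3.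
  by rewrite -{1}(odd_double_half p) o.
have [d qE] : exists d, (2 ^ (p - 1) = 1 + p * d)%N.
  have /dvdnP[d dE] : (p %| 2 ^ (p - 1) - 1)%N.
    rewrite (dvdn_pcharf pF) natrB ?expn_gt0 // natrX (_ : p - 1 = n.*2)%N; last by lia.
    rewrite (fermat_little pE (card_Fp p_prime)) ?subrr //.
    exact: (two_neq0 pF pE).
  by exists d; rewrite mulnC -dE subnKC ?expn_gt0.
have qd : q = d%:R.
  rewrite /q /fermat_quotient qE natrD addrC addKr natrM mulrAC divff ?mul1r //.
  by rewrite pnatr_eq0 -lt0n.
have red8 := reduces_S8 p_prime pE p_gt3.
have red512 := reduces_S512 p_prime pE p_gt3.
have rq : reduces_to q (d%:R : 'F_p) by rewrite qd; apply: reduces_nat.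
have r k : reduces_to k%:R (k%:R : 'F_p) by apply: reduces_nat.
have r1 : reduces_to 1 (1 : 'F_p) := r 1%N.
have three : 3 != 0 :> 'F_p by apply: (natr_neq0 pF).
have nn : p = 3 %[mod 4] -> odd n by move=> ?; lia.
split; split.
- move=> x y pxy ox; apply: (reduces_eqmod pF) red8 _.
  have en := sum_two_squares_mod4 pE pxy ox.
  have nE : n = n./2.*2 by rewrite -{1}(odd_double_half n) (negPf en).
  have [-> _] := congruences_even p_prime pE p_gt3 nE qE pxy ox.
  apply/reduces_opp/reduces_div => //; apply: reduces_mul; last exact/reduces_exp/reduces_int.
  by apply: reduces_mul => //; apply: reduces_add.
- move=> /nn on; apply: (reduces_eqmod pF) red8 _.
  by have [-> _] := congruences_odd p_prime pE p_gt3 on; exact: r 0%N.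
- move=> x y pxy ox; apply: (reduces_eqmod pF) red512 _.
  have en := sum_two_squares_mod4 pE pxy ox.
  have nE : n = n./2.*2 by rewrite -{1}(odd_double_half n) (negPf en).
  have [_ ->] := congruences_even p_prime pE p_gt3 nE qE pxy ox.
  apply/reduces_opp/reduces_div => //; apply: reduces_mul; last exact/reduces_exp/reduces_int.
  by apply: reduces_add => //; apply: reduces_mul.
- move=> /nn on; apply: (reduces_eqmod pF) red512 _.
  by have [_ ->] := congruences_odd p_prime pE p_gt3 on; exact: r 0%N.
Qed.
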